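(* Let $K\in\mathbb N$, $p_1,\dots,p_K>0$ with $\sum_k p_k=1$, $\sigma_1^2,\dots,\sigma_K^2>0$, and $h\sim\sum_{k=1}^K p_k\mathcal N_{\mathbb C}(0,\sigma_k^2)$. For $M\in\mathbb N$ and $\mathbf a\in\mathbb C^M$ with $\|\mathbf a\|_2^2=M$, consider the noiseless one-bit observation $\mathbf r=Q(\mathbf a h)\in\mathbb C^M$, where $Q(x)=\frac1{\sqrt2}(\operatorname{sign}(\operatorname{Re}x)+\mathrm j\operatorname{sign}(\operatorname{Im}x))$ is applied element-wise. Then the mean square error $\mathbb E[|h-\mathbb E[h\mid\mathbf r]|^2]$ of the conditional mean estimator is minimized by the pilot sequence $[\mathbf a]_m=\exp(\mathrm j\psi_m)$ with equidistant phase shifts $\psi_m=\frac{\pi(m-1)}{2M}$, $m=1,\dots,M$.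
   Context: $\mathcal N_{\mathbb C}(0,\sigma^2)$ denotes the circularly symmetric complex Gaussian distribution with variance $\sigma^2$. The minimization is over the pilot vectors $\mathbf a$ satisfying the power constraint. *)

(* Defs.v *)
From HB Require Import structures.
From mathcomp Require Import all_boot all_order all_algebra.
From mathcomp Require Import all_classical all_reals all_analysis.
From mathcomp Require Import complex.
Set Implicit Arguments. Unset Strict Implicit. Unset Printing Implicit Defensive.
Import Order.TTheory GRing.Theory Num.Theory.
Import numFieldNormedType.Exports.
Local Open Scope classical_set_scope.
Local Open Scope ring_scope.

Section OneBit.
Variable R : realType.

(* The complex plane C = R[i] is identified with R * R (real / imaginary part);
   the channel h is described by its density w.r.t. Lebesgue measure on R * R. *)
Definition cplx (z : R * R) : R[i] := Complex z.1 z.2.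

Definition abs2 (z : R[i]) : R := (complex.Re z) ^+ 2 + (complex.Im z) ^+ 2.

Definition leb2 := ((@lebesgue_measure R) \x (@lebesgue_measure R))%E.

(* density of CN(0, s) (s = variance) on C ~ R^2 *)
Definition cn_density (s : R) (z : R * R) : R :=
  (pi * s)^-1 * expR (- (z.1 ^+ 2 + z.2 ^+ 2) / s).

Definition mix_density (K : nat) (p s : 'I_K -> R) (z : R * R) : R :=
  \sum_(k < K) p k * cn_density (s k) z.

Definition Emix (K : nat) (p s : 'I_K -> R) (f : R * R -> R) : \bar R :=
  (\int[leb2]_(z in setT) (f z * mix_density p s z)%:E)%E.

(* sign with the convention sign(0) = 1 (a null event) *)
Definition sgn (x : R) : R := if 0 <= x then 1 else -1.

Definition Q (x : R[i]) : R[i] :=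
  Complex (sgn (complex.Re x) / Num.sqrt 2) (sgn (complex.Im x) / Num.sqrt 2).

Definition obs (M : nat) (a : 'I_M -> R[i]) (z : R * R) : 'I_M -> R[i] :=
  fun m => Q (a m * cplx z).

Definition obs_event (M : nat) (a : 'I_M -> R[i]) (v : 'I_M -> R[i]) : set (R * R) :=
  [set z | obs a z = v].

Definition indic (A : set (R * R)) (z : R * R) : R := if `[< A z >] then 1 else 0.

(* conditional mean E[h | r = v] for the discrete observation r:
   E[h 1{r = v}] / P(r = v)  (set to 0 on null events) *)
Definition cond_mean (K : nat) (p s : 'I_K -> R) (M : nat) (a : 'I_M -> R[i])
    (v : 'I_M -> R[i]) : R[i] :=
  let P := fine (Emix p s (indic (obs_event a v))) in
  if P == 0 then 0 else
  Complex (fine (Emix p s (fun z => z.1 * indic (obs_event a v) z)) / P)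
          (fine (Emix p s (fun z => z.2 * indic (obs_event a v) z)) / P).

Definition mse_cme (K : nat) (p s : 'I_K -> R) (M : nat) (a : 'I_M -> R[i]) : \bar R :=
  Emix p s (fun z => abs2 (cplx z - cond_mean p s a (obs a z))).

(* pilot with equidistant phases psi_m = pi (m-1) / (2M), m = 1..M
   (here m is 0-indexed, so psi_m = pi m / (2M)) *)
Definition equi_pilot (M : nat) : 'I_M -> R[i] :=
  fun m => Complex (cos (pi * m%:R / (2 * M%:R))) (sin (pi * m%:R / (2 * M%:R))).

End OneBit.

(* Main.v *)
(** The density of [h] is radial, so the noiseless observation only depends on the phase
    of [h], and it is constant on sectors cut out by the [2 M] lines through the origin
    attached to the pilots, hence takes at most [4 M] values up to null sets.  A cell of
    angular measure [T] lowers the mean square error by at most a constant multiple of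
    [2 (1 - cos T) / T] (bathtub principle), a concave function of [T].  Its tangent at
    [pi / (2 M)] bounds the total gain over at most [4 M] cells of total angle [2 pi],
    and the equidistant phases, whose lines cut the plane into [4 M] equal sectors, attain
    this bound. *)
Require Import Defs.
From HB Require Import structures.
From mathcomp Require Import all_boot all_order all_algebra.
From mathcomp Require Import all_classical all_reals all_analysis.
From mathcomp Require Import measurable_realfun.
From mathcomp Require Import complex.
From mathcomp Require Import ring lra zify.
Set Implicit Arguments. Unset Strict Implicit. Unset Printing Implicit Defensive.
Import Order.TTheory GRing.Theory Num.Theory.
Import numFieldNormedType.Exports.
Local Open Scope classical_set_scope.
Local Open Scope ring_scope.

(** * Concavity of the gain of a sector *)

Section trig.
Variable R : realType.
Implicit Types a b t u : R.

(** The two bounds treat the conditional mean differently. The lower bound holds for an arbitrary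
    representative [c] of a cell and involves the cell only through its angular measure [Theta], so
    the cells of a general pilot are counted but never described. The upper bound uses only that the
    conditional mean does at least as well as any other choice of representatives, in particular the
    centroids of equal sectors. Expanding |z - c|^2 leaves a single term that depends on the shape
    of the cell, its first moment in the direction of [c]. The radial law enters through its moments
    alone, and the constant multiple is [gain], that is [mom 1 ^+ 2 / mom 0]. The point of tangency
    pi / (2 M) is 2 pi / (4 M), the common angle of 4 M equal cells. Only an upper bound on the
    number of cells is available, so the intercept of the tangent must be nonnegative; its slope
    must be nonnegative as well, which holds up to pi / 2. Angles are measured through the slope y /
    x with weight 1 / (1 + t^2), which reduces polar coordinates to Tonelli and scalings of the
    line. *)

Lemma cos_antitone a b : 0 <= a -> a <= b -> b <= pi -> cos b <= cos a :> R.
Proof.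
move=> a0 ab bpi; rewrite leNgt; apply/negP => cc.
have := @ltr_cos R b a; rewrite !in_itv /= => H.
have : b < a by rewrite -H ?cc //; lra.
lra.
Qed.

Lemma MVT_derive (f df : R -> R) a b : a <= b ->
  (forall x, is_derive x (1:R) f (df x)) ->
  exists2 c, a <= c <= b & f b - f a = df c * (b - a).
Proof.
move=> ab fd; have [c cab E] : exists2 c, c \in `[a, b]%R & f b - f a = df c * (b - a).
  apply: MVT_segment => //.
  apply: continuous_subspaceT => x; apply: differentiable_continuous.
  by apply/derivable1_diffP; case: (fd x).
by exists c => //; move: cab; rewrite in_itv.
Qed.

Lemma sin_le_tangent a b : 0 <= a <= pi -> 0 <= b <= pi ->
  sin b <= sin a + cos a * (b - a) :> R.
Proof.
move=> a0 b0; case: (leP a b) => ab.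
  have [c cab E] := MVT_derive ab (@is_derive_sin R).
  have ? : cos c <= cos a by apply: cos_antitone; lra.
  have := ler_wpM2r (_ : 0 <= b - a) (_ : cos c <= cos a) => H.
  have := H ltac:(lra) ltac:(lra); lra.
have [c cab E] := MVT_derive (ltW ab) (@is_derive_sin R).
have ? : cos a <= cos c by apply: cos_antitone; lra.
have := ler_wpM2r (_ : 0 <= a - b) (_ : cos a <= cos c) => H.
have := H ltac:(lra) ltac:(lra); lra.
Qed.

(** The numerator 2 (1 - cos t) is the squared chord of the arc t. Up to the factor [gain],
    [chord t] is what a sector of angle t saves when its representative moves from the origin to its
    centroid. [chord_slope u] is the derivative of [chord] at u, and [chord_icept u] is the
    intercept of the tangent there. *)
Definition chord t : R := 2 * (1 - cos t) / t.
Definition chord_slope u : R := 2 * (sin u / u - (1 - cos u) / u ^+ 2).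
Definition chord_icept u : R := chord u - chord_slope u * u.

(* [chord t = 2 \int_0^1 sin (t x) dx], so its concavity follows from that of sin;
   the integral is replaced by an antiderivative in [x]. *)
Lemma chord_le_tangent t u : 0 < t <= pi -> 0 < u <= pi ->
  chord t <= chord_slope u * t + chord_icept u.
Proof.
move=> t0 u0.
pose F x : R := (1 - cos (u * x)) / u
  + (t - u) * (x * sin (u * x) / u - (1 - cos (u * x)) / u ^+ 2)
  - (1 - cos (t * x)) / t.
pose f x : R := sin (u * x) + cos (u * x) * (t * x - u * x) - sin (t * x).
have tn0 : t != 0 by apply: lt0r_neq0; lra.
have un0 : u != 0 by apply: lt0r_neq0; lra.
have Fd (x : R) : is_derive x (1:R) F (f x).
  rewrite /F; apply: is_derive_eq; rewrite /f /GRing.scale /=.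
  by field; rewrite tn0 un0.
have [c c01] := MVT_derive (@ler01 R) Fd.
have -> : F 0 = 0 by rewrite /F !mulr0 cos0 sin0 !(mul0r,mulr0,subrr,subr0,addr0).
have fc : 0 <= f c.
  have := @sin_le_tangent (u * c) (t * c); rewrite /f => H.
  have H1 : 0 <= u * c <= pi by apply/andP; split; nra.
  have H2 : 0 <= t * c <= pi by apply/andP; split; nra.
  have := H H1 H2; lra.
rewrite !subr0 mulr1 => E; rewrite -{}E in fc.
rewrite -subr_ge0; suff -> : chord_slope u * t + chord_icept u - chord t = 2 * F 1 by lra.
rewrite /chord_icept /chord /chord_slope /F !mulr1 mul1r.
by field; rewrite tn0 un0.
Qed.

(** By the mean value theorem 1 - cos u = u sin c for some c in [0, u], and sin increases up to pi /
    2, so 1 - cos u <= u sin u. *)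
Lemma chord_slope_ge0 u : 0 < u <= pi / 2 -> 0 <= chord_slope u.
Proof.
move=> u0; have pi2 := @pi_ge2 R.
have [c cab E] := MVT_derive (ltW (andP u0).1) (@is_derive_cos R).
have H : sin c <= sin u.
  have := @cos_antitone (pi / 2 - u) (pi / 2 - c).
  by rewrite !cosB cos_pihalf sin_pihalf !mul0r !mul1r !add0r; apply; lra.
have un0 : u != 0 by apply: lt0r_neq0; lra.
rewrite /chord_slope; apply: mulr_ge0 => //.
have -> : sin u / u - (1 - cos u) / u ^+ 2 = (sin u * u - (1 - cos u)) / u ^+ 2 by field.
apply: divr_ge0; last exact: sqr_ge0.
move: E; rewrite cos0 subr0 => E.
have : sin c * u <= sin u * u by apply: ler_wpM2r => //; lra.
lra.
Qed.

Lemma half_angle t : 1 - cos t = 2 * sin (t / 2) ^+ 2 :> R.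
Proof.
rewrite {1}(splitr t) cosD -!expr2 sin2cos2; lra.
Qed.

Lemma chord_icept_ge0 u : 0 < u <= pi -> 0 <= chord_icept u.
Proof.
move=> u0; have un0 : u != 0 by apply: lt0r_neq0; lra.
have -> : chord_icept u = 2 * (2 * (1 - cos u) - u * sin u) / u.
  by rewrite /chord_icept /chord /chord_slope; field.
apply: divr_ge0; last lra.
apply: mulr_ge0 => //.
have -> : sin u = 2 * sin (u / 2) * cos (u / 2).
  by rewrite {1}(splitr u) sinD; lra.
rewrite half_angle.
have := @sin_le_tangent (u / 2) 0; rewrite sin0 => H.
have H1 : 0 <= u / 2 <= pi by apply/andP; split; lra.
have H2 : (0:R) <= 0 <= (pi : R) by rewrite lexx pi_ge0.
have {H2}H := H H1 H2.
have : 0 <= sin (u / 2) by apply: sin_ge0_pi.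
by nra.
Qed.

(* The left side, as a function of [r], is maximal at [r = sin d / d]. *)
Lemma bathtub_gap r d u : 0 < d < pi / 2 -> 0 < u <= pi ->
  4 * r * sin d - (r ^+ 2 + chord_slope u) * (2 * d) <= chord_icept u.
Proof.
move=> d0 u0; have dn0 : d != 0 by apply: lt0r_neq0; lra.
have H : 0 < 2 * d <= pi by lra.
have {H} := chord_le_tangent H u0.
have -> : chord (2 * d) = 2 * sin d ^+ 2 / d.
  rewrite /chord half_angle (_ : 2 * d / 2 = d); last by field.
  by field.
have -> : 2 * sin d ^+ 2 / d = 4 * r * sin d - 2 * d * r ^+ 2 + 2 * d * (r - sin d / d) ^+ 2.
  by field.
have : 0 <= 2 * d * (r - sin d / d) ^+ 2 by apply: mulr_ge0; [lra|exact: sqr_ge0].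
lra.
Qed.

End trig.

(** * Invariance of Lebesgue measure under rotations *)

Section lebesgue_line.
Context {R : realType}.
Local Notation mu := (@lebesgue_measure R).
Local Notation TR := (measurableTypeR R).

Lemma ge0_integral_translate (a : R) (f : R -> \bar R) :
  measurable_fun setT f -> (forall x, 0 <= f x)%E ->
  (\int[mu]_x f (x + a)%R = \int[mu]_x f x)%E.
Proof.
move=> mf f0.
have mt : measurable_fun setT ((fun x => x + a) : TR -> TR).
  by apply: measurable_funD.
rewrite (_ : (fun x => f (x + a)) = f \o (fun x => x + a))//.
rewrite -[X in (integral _ X _ = _)%E](preimage_setT (fun x : R => x + a)).
rewrite -(ge0_integral_pushforward mt)//.
apply: eq_measure_integral => A mA _.
rewrite [LHS](_ : _ = pushforward mu ((fun x => x + a) : TR -> TR) A)//.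
apply/esym; apply: (@lebesgue_measure_unique R (pushforward mu ((fun x => x + a) : TR -> TR))) => //.
move=> _ [[b c]] _ <-.
have E : (fun x : R => x + a) @^-1` [set` `]b, c]] = [set` `](b - a), (c - a)]].
  by apply/seteqP; split => x /=; rewrite !in_itv /=; lra.
rewrite [RHS](_ : _ = mu [set` `](b - a), (c - a)]]); last by rewrite -E.
rewrite !lebesgue_measure_itv /= !lte_fin ltrD2r; case: ifP => // _.
by rewrite -!EFinB; congr (_%:E); lra.
Qed.

Lemma ge0_integral_scale (c : R) (f : R -> \bar R) : c != 0 ->
  measurable_fun setT f -> (forall x, 0 <= f x)%E ->
  (\int[mu]_x f x = `|c|%:E * \int[mu]_x f (c * x)%R)%E.
Proof.
wlog c0 : c f / 0 < c => [H cn0 mf f0|_ mf f0].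
  have [c0|c0|c0] := ltgtP 0 c; first exact: H.
    rewrite -(normrN c) (H (- c))//; [|lra|by rewrite oppr_eq0].
    congr (_ * _)%E.
    rewrite (_ : (fun x => f (- c * x)) = (fun x => f (c * x)) \o -%R); last first.
      by apply/funext => x /=; congr f; lra.
    have mN : measurable_fun setT (-%R : TR -> TR) by [].
    transitivity (\int[pushforward mu (-%R : TR -> TR)]_x f (c * x)%R)%E.
      rewrite (ge0_integral_pushforward mN)//.
      by apply: measurableT_comp => //; apply: measurable_funM.
    apply: eq_measure_integral => A mA _.
    exact: lebesgue_measureN.
  by rewrite -c0 eqxx in cn0.
have cn0 : c != 0 by rewrite gt_eqF.
have mt : measurable_fun setT ((fun x => c * x) : TR -> TR).
  by apply: measurable_funM.
rewrite (_ : (fun x => f (c * x)) = f \o (fun x => c * x))//.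
rewrite -[X in (_ = _ * integral _ X _)%E](preimage_setT (fun x : R => c * x)).
rewrite -(ge0_integral_pushforward mt)//.
pose k : {nonneg R} := NngNum (normr_ge0 c).
rewrite -[`|c|]/(k%:num) -ge0_integral_mscale//.
apply: eq_measure_integral => A mA _.
apply: (@lebesgue_measure_unique R (mscale k (pushforward mu ((fun x => c * x) : TR -> TR)))) => //.
move=> _ [[a b]] _ <-.
have E : (fun x : R => c * x) @^-1` [set` `]a, b]] = [set` `](a / c), (b / c)]].
  by apply/seteqP; split => x /=; rewrite !in_itv /= ltr_pdivrMr// ler_pdivlMr//; rewrite (mulrC x); lra.
rewrite [RHS](_ : _ = (`|c|%:E * mu [set` `](a / c)%R, (b / c)%R]])%E); last by rewrite -E.
rewrite !lebesgue_measure_itv /= !lte_fin ltr_pM2r ?invr_gt0//; case: ifP => _; last by rewrite mule0.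
rewrite -!EFinB -EFinM; congr (_%:E).
by rewrite gtr0_norm//; field.
Qed.

End lebesgue_line.

Section rotation.
Context {R : realType}.
Local Notation mu := (@lebesgue_measure R).
Local Notation TR := (measurableTypeR R).
Local Notation mu2 := ((@lebesgue_measure R) \x (@lebesgue_measure R))%E.
Implicit Types (f : R * R -> \bar R) (phi psi : R * R -> R * R).

(** Measure preservation stated through integrals: it composes at once, and for shears it comes
    directly from Tonelli. *)
Definition ge0_invariant phi := measurable_fun setT phi /\
  forall f, measurable_fun setT f -> (forall z, 0 <= f z)%E ->
    (\int[mu2]_z f (phi z) = \int[mu2]_z f z)%E.

Lemma ge0_invariant_comp phi psi :
  ge0_invariant phi -> ge0_invariant psi -> ge0_invariant (psi \o phi).
Proof.
move=> [mphi Hphi] [mpsi Hpsi]; split; first exact: measurableT_comp.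
move=> f mf f0; rewrite -(Hpsi f)// -(Hphi (f \o psi))//.
  exact: measurableT_comp.
by move=> z /=.
Qed.

(** With the first coordinate fixed, the shear is a translation of the second, so the inner Tonelli
    integral is unchanged. *)
Lemma ge0_invariant_shear2 (k : R) :
  ge0_invariant (fun z => (z.1, z.2 + k * z.1)).
Proof.
have mphi : measurable_fun setT (fun z : R * R => (z.1, z.2 + k * z.1)).
  by apply: measurable_fun_pair => //; apply: measurable_funD => //; apply: measurable_funM.
split => // f mf f0.
have mf' : measurable_fun setT (f \o (fun z : R * R => (z.1, z.2 + k * z.1))).
  exact: measurableT_comp.
rewrite (@fubini_tonelli1 _ _ _ _ R mu mu _ mf'); last by move=> z /=.
rewrite (@fubini_tonelli1 _ _ _ _ R mu mu _ mf)//.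
apply: eq_integral => x _; rewrite /fubini_F /=.
apply: (@ge0_integral_translate R (k * x) (fun y => f (x, y))) => //.
exact: measurableT_comp.
Qed.

Lemma ge0_invariant_shear1 (k : R) :
  ge0_invariant (fun z => (z.1 + k * z.2, z.2)).
Proof.
have mphi : measurable_fun setT (fun z : R * R => (z.1 + k * z.2, z.2)).
  by apply: measurable_fun_pair => //; apply: measurable_funD => //; apply: measurable_funM.
split => // f mf f0.
have mf' : measurable_fun setT (f \o (fun z : R * R => (z.1 + k * z.2, z.2))).
  exact: measurableT_comp.
rewrite (@fubini_tonelli2 _ _ _ _ R mu mu _ mf'); last by move=> z /=.
rewrite (@fubini_tonelli2 _ _ _ _ R mu mu _ mf)//.
apply: eq_integral => x _; rewrite /fubini_G /=.
apply: (@ge0_integral_translate R (k * x) (fun y => f (y, x))) => //.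
exact: measurableT_comp.
Qed.

(** Complex multiplication by [g]; for unit [g] the inverse is multiplication by the conjugate
    [(g.1, - g.2)]. *)
Definition rotz (g z : R * R) : R * R := (g.1 * z.1 - g.2 * z.2, g.2 * z.1 + g.1 * z.2).

(* A rotation with nonzero sine is a product of three shears. *)
Lemma ge0_invariant_rot g : g.1 ^+ 2 + g.2 ^+ 2 = 1 -> ge0_invariant (rotz g).
Proof.
have shears (c s : R) : s != 0 -> c ^+ 2 + s ^+ 2 = 1 -> ge0_invariant (rotz (c, s)).
  move=> s0 cs.
  rewrite (_ : rotz (c, s) = (fun z => (z.1 + (c - 1) / s * z.2, z.2)) \o
    ((fun z => (z.1, z.2 + s * z.1)) \o (fun z => (z.1 + (c - 1) / s * z.2, z.2)))).
    apply: ge0_invariant_comp; last exact: ge0_invariant_shear1.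
    apply: ge0_invariant_comp; last exact: ge0_invariant_shear2.
    exact: ge0_invariant_shear1.
  apply/funext => -[x y] /=; rewrite /rotz /=; congr pair; last by field.
  have -> : - (s * y) = (c ^+ 2 - 1) / s * y.
    by rewrite (_ : c ^+ 2 - 1 = - s ^+ 2); [field|lra].
  by field.
case: g => c s /= cs; have [s0|] := eqVneq s 0; last by move=> s0; exact: shears.
have [c1|c1] : c = 1 \/ c = -1.
  have /eqP : (c - 1) * (c + 1) = 0 by rewrite s0 in cs; lra.
  by rewrite mulf_eq0 => /orP[/eqP|/eqP] ?; [left|right]; lra.
- rewrite (_ : rotz (c, s) = id); first by split.
  by apply/funext => -[x y]; rewrite /rotz s0 c1 /=; congr pair; lra.
(* The half turn has zero sine, so it is taken as the square of the quarter turn. *)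
- rewrite (_ : rotz (c, s) = rotz (0, 1) \o rotz (0, 1)).
    by apply: ge0_invariant_comp; apply: shears; rewrite ?oner_eq0//; lra.
  by apply/funext => -[x y]; rewrite /rotz s0 c1 /=; congr pair; lra.
Qed.

Lemma measurable_rotz g : measurable_fun setT (rotz g).
Proof.
apply: measurable_fun_pair.
  by apply: measurable_funB; apply: measurable_funM.
by apply: measurable_funD; apply: measurable_funM.
Qed.

Lemma integral_rot g f : g.1 ^+ 2 + g.2 ^+ 2 = 1 -> measurable_fun setT f ->
  (\int[mu2]_z f (rotz g z) = \int[mu2]_z f z)%E.
Proof.
move=> g1 mf; have [_ H] := ge0_invariant_rot g1.
rewrite integralE [RHS]integralE.
congr (_ - _)%E.
  transitivity (\int[mu2]_z (f^\+)%E (rotz g z))%E; first by apply: eq_integral => z _; rewrite !funeposE.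
  rewrite -[RHS](H (f^\+)%E); [by []|exact: measurable_funepos|by move=> z; exact: funepos_ge0].
transitivity (\int[mu2]_z (f^\-)%E (rotz g z))%E; first by apply: eq_integral => z _; rewrite !funenegE.
by rewrite -[RHS](H (f^\-)%E); [by []|exact: measurable_funeneg|move=> z; exact: funeneg_ge0].
Qed.

Lemma sqr_norm_rotz g z : (rotz g z).1 ^+ 2 + (rotz g z).2 ^+ 2 =
  (g.1 ^+ 2 + g.2 ^+ 2) * (z.1 ^+ 2 + z.2 ^+ 2).
Proof. by rewrite /rotz /=; ring. Qed.

Lemma rotzK g z : g.1 ^+ 2 + g.2 ^+ 2 = 1 -> rotz (g.1, - g.2) (rotz g z) = z.
Proof.
move=> g1; case: z => x y; rewrite /rotz /=; congr pair.
  by rewrite -[RHS]mul1r -g1; ring.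
by rewrite -[RHS]mul1r -g1; ring.
Qed.

End rotation.

(** * Integrals over cones *)

Section polar.
Context {R : realType}.
Local Notation mu := (@lebesgue_measure R).
Local Notation mu2 := ((@lebesgue_measure R) \x (@lebesgue_measure R))%E.

Definition sqn (z : R * R) : R := z.1 ^+ 2 + z.2 ^+ 2.

Lemma sqn_ge0 z : 0 <= sqn z.
Proof. by rewrite addr_ge0// sqr_ge0. Qed.

Lemma measurable_sqn : measurable_fun setT sqn.
Proof. by apply: measurable_funD; apply: measurable_funX. Qed.

Lemma measurable_sqrt : measurable_fun setT (@Num.sqrt R).
Proof. by apply: continuous_measurable_fun => x; exact: sqrt_continuous. Qed.

Lemma measurable_norm2 : measurable_fun setT (fun z => Num.sqrt (sqn z)).
Proof. exact: (measurableT_comp measurable_sqrt measurable_sqn). Qed.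

(* Polar coordinates for functions that are constant on punctured lines, with the
   slope [t = y / x] in place of the angle. *)
Lemma integral_polar (w : R * R -> R) (q : R -> R) (j : nat) :
  measurable_fun setT w -> (forall z, 0 <= w z) ->
  (forall (r : R) z, r != 0 -> w (r * z.1, r * z.2) = w z) ->
  measurable_fun setT q -> (forall t, 0 <= q t) ->
  (\int[mu2]_z (w z * Num.sqrt (sqn z) ^+ j * q (sqn z))%:E =
   (\int[mu]_x (`|x| ^+ j.+1 * q (x ^+ 2))%:E) *
   \int[mu]_t (w (1, t) / (1 + t ^+ 2))%:E)%E.
Proof.
move=> mw w0 whom mq q0.
pose F z : \bar R := (w z * Num.sqrt (sqn z) ^+ j * q (sqn z))%:E.
have F0 z : (0 <= F z)%E by rewrite lee_fin !mulr_ge0// exprn_ge0// sqrtr_ge0.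
have mF : measurable_fun setT F.
  apply/measurable_EFinP; apply: measurable_funM.
    by apply: measurable_funM => //; apply: measurable_funX; exact: measurable_norm2.
  exact: (measurableT_comp mq measurable_sqn).
(* [G] is the integrand after the substitution y = x t, with Jacobian |x|. The substitution fails at
   x = 0, which is discarded below as a null set. *)
pose G (z : R * R) : \bar R := (`|z.1|%:E * F (z.1, z.1 * z.2)%R)%E.
have G0 z : (0 <= G z)%E by rewrite mule_ge0.
have mG : measurable_fun setT G.
  apply: emeasurable_funM.
    by apply/measurable_EFinP; apply: measurableT_comp.
  apply: measurableT_comp => //; apply: measurable_fun_pair => //.
  exact: measurable_funM.
rewrite (@fubini_tonelli1 _ _ _ _ R mu mu _ mF)//.
transitivity (\int[mu]_x \int[mu]_t G (x, t))%E.
  have mD : measurable ([set: R] `\ 0) by exact: measurableD.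
  rewrite -(integral_setD1 mD); last first.
    by apply: measurable_funTS; exact: (@measurable_fun_fubini_tonelli_F _ _ _ _ R mu).
  rewrite -[RHS](integral_setD1 mD); last first.
    by apply: measurable_funTS; exact: (@measurable_fun_fubini_tonelli_F _ _ _ _ R mu _ mG).
  apply: eq_integral => x; rewrite inE /= => -[_ /eqP x0].
  rewrite /fubini_F (ge0_integral_scale x0)//; last exact: measurableT_comp.
  rewrite -ge0_integralZl//.
  apply: (measurableT_comp (f := fun y => F (x, y))); first exact: measurableT_comp.
  exact: measurable_funM.
rewrite (@fubini_tonelli _ _ _ _ R mu mu _ mG)//.
pose k (u : R) : \bar R := (`|u| ^+ j.+1 * q (u ^+ 2))%:E.
have mk : measurable_fun setT k.
  apply/measurable_EFinP; apply: measurable_funM.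
    by apply: measurable_funX; exact: normr_measurable.
  by apply: measurableT_comp => //; exact: measurable_funX.
have k0 u : (0 <= k u)%E by rewrite lee_fin mulr_ge0// exprn_ge0.
have mw1 : measurable_fun setT (fun t : R => w (1, t) / (1 + t ^+ 2)).
  apply: measurable_funM; first exact: measurableT_comp.
  apply: continuous_measurable_fun; exact: continuous_oneDsqrV.
have w1_ge0 t : 0 <= w (1, t) / (1 + t ^+ 2).
  by rewrite divr_ge0// addr_ge0// sqr_ge0.
have intk : (0 <= \int[mu]_x k x)%E by exact: integral_ge0.
rewrite -ge0_integralZl//; last 2 first.
- exact/measurable_EFinP.
- by move=> t _; rewrite lee_fin.
apply: eq_integral => t _.
(* [c] is the norm of (1, t). Substituting u = c x turns c^j |x|^(j+1) dx into c^(-2) |u|^(j+1) du,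
   which is the origin of the weight 1 / (1 + t^2). *)
pose c := Num.sqrt (1 + t ^+ 2).
have t1 : 0 < 1 + t ^+ 2 by rewrite ltr_pwDl// sqr_ge0.
have c0 : 0 < c by rewrite sqrtr_gt0.
have c2 : c ^+ 2 = 1 + t ^+ 2 by rewrite sqr_sqrtr// ltW.
rewrite (ge0_integral_scale (lt0r_neq0 c0) mk k0) muleC muleA -EFinM.
rewrite -ge0_integralZl//; last 2 first.
- by apply: measurableT_comp => //; exact: measurable_funM.
- by rewrite lee_fin mulr_ge0.
apply: eq_integral => x _.
rewrite /G /F /k /= -!EFinM; congr (_%:E).
have -> : sqn (x, x * t) = (c * x) ^+ 2.
  by rewrite exprMn c2 /sqn /=; ring.
have [->|x0] := eqVneq x 0; first by rewrite normr0 mul0r mulr0 normr0 expr0n /= !(mul0r, mulr0).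
have -> : w (x, x * t) = w (1, t) by rewrite -(whom x (1, t) x0) /= mulr1.
rewrite sqrtr_sqr normrM (gtr0_norm c0) !exprMn -!c2.
rewrite (exprS c j) (exprS `|x| j).
move: (lt0r_neq0 c0) (`|x|) (q _) (w _) => cn0 a b d.
by field.
Qed.

End polar.

(** * Angular integrals in the slope coordinate *)

Section one_dim.
Context {R : realType}.
Local Notation mu := (@lebesgue_measure R).

Lemma integralT_oneDsqrV : (\int[mu]_t ((1 + t ^+ 2)^-1)%:E = (pi : R)%:E)%E.
Proof.
rewrite ge0_symfun_integralT.
- rewrite -set_itvcy (integral0y_oneDsqr R) -EFinM; congr (_%:E); lra.
- by move=> x; rewrite invr_ge0 addr_ge0// sqr_ge0.
- exact: continuous_oneDsqrV.
- by move=> x /=; rewrite sqrrN.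
Qed.

Lemma integral_derive_itv (F f : R -> R) (a b : R) : a < b ->
  (forall x, is_derive x (1:R) F (f x)) -> continuous f ->
  (\int[mu]_(x in `[a, b]) (f x)%:E = (F b - F a)%:E)%E.
Proof.
move=> ab dF cf.
have cF x : {for x, continuous F}.
  by apply: differentiable_continuous; apply/derivable1_diffP; case: (dF x).
rewrite (@continuous_FTC2 _ f F a b ab)//.
- by apply: continuous_subspaceT.
- split.
  + by move=> x _; case: (dF x).
  + by apply: cvg_at_right_filter; exact: cF.
  + by apply: cvg_at_left_filter; exact: cF.
- by move=> x _; rewrite derive1E; exact: derive_val.
Qed.

Lemma integral_itv_oneDsqrV (d : R) : 0 < d < pi / 2 ->
  (\int[mu]_(t in `[(- tan d)%R, (tan d)%R]) ((1 + t ^+ 2)^-1)%:E = (2 * d)%:E)%E.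
Proof.
move=> d0; have td : 0 < tan d.
  by rewrite divr_gt0 ?sin_gt0_pihalf// cos_gt0_pihalf//; lra.
rewrite (@integral_derive_itv atan)//.
- rewrite atanN tanK; last by rewrite in_itv /=; lra.
  by congr (_%:E); lra.
- lra.
- exact: continuous_oneDsqrV.
Qed.

(** The first factor is cos (atan t), so the integrand is the derivative of sin (atan t): this is
    the integral of cos over [- d, d]. *)
Lemma integral_itv_cos_atan (d : R) : 0 < d < pi / 2 ->
  (\int[mu]_(t in `[(- tan d)%R, (tan d)%R]) ((Num.sqrt (1 + t ^+ 2))^-1 / (1 + t ^+ 2))%:E
   = (2 * sin d)%:E)%E.
Proof.
move=> d0; have td : 0 < tan d.
  by rewrite divr_gt0 ?sin_gt0_pihalf// cos_gt0_pihalf//; lra.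
have dF (x : R) : is_derive x (1:R) (fun t => sin (atan t))
    ((Num.sqrt (1 + x ^+ 2))^-1 / (1 + x ^+ 2)).
  have H := is_derive1_atan x.
  by apply: is_derive_eq; rewrite cos_atan /GRing.scale /= mulrC.
have cf : continuous (fun t : R => (Num.sqrt (1 + t ^+ 2))^-1 / (1 + t ^+ 2)).
  move=> x; apply: cvgM; last exact: continuous_oneDsqrV.
  rewrite -cos_atan (_ : (fun t => _) = cos \o atan); last first.
    by apply/funext => t /=; rewrite cos_atan.
  by apply: continuous_comp; [exact: continuous_atan|exact: continuous_cos].
rewrite (integral_derive_itv _ dF cf); last lra.
rewrite atanN sinN tanK; last by rewrite in_itv /=; lra.
by congr (_%:E); lra.
Qed.

End one_dim.

(** * Integrals against a radial weight *)

Section radial.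
Context {R : realType}.
Local Notation mu := (@lebesgue_measure R).
Local Notation mu2 := ((@lebesgue_measure R) \x (@lebesgue_measure R))%E.
Variables (q : R -> R).
Hypothesis mq : measurable_fun setT q.
Hypothesis q0 : forall t, 0 <= q t.
Implicit Types (F G : R * R -> R) (A : set (R * R)).

(** Here [q] is the density as a function of the squared modulus. The exponent [j.+1] contains the
    polar Jacobian, and integrating over the whole line counts each radius twice. *)
Definition moment (j : nat) : \bar R := (\int[mu]_x (`|x| ^+ j.+1 * q (x ^+ 2))%:E)%E.
Definition rho (z : R * R) := Num.sqrt (sqn z).
Definition Ex F : R := fine (\int[mu2]_z (F z * q (sqn z))%:E).

Lemma sqn_scale (r : R) z : sqn (r * z.1, r * z.2) = r ^+ 2 * sqn z.
Proof. by rewrite /sqn /=; ring. Qed.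

Lemma rho_scale (r : R) z : rho (r * z.1, r * z.2) = `|r| * rho z.
Proof. by rewrite /rho sqn_scale sqrtrM ?sqr_ge0// sqrtr_sqr. Qed.

Lemma measurable_qsqn : measurable_fun setT (fun z : R * R => q (sqn z)).
Proof. exact: (measurableT_comp mq measurable_sqn). Qed.

Lemma measurable_EFinq F : measurable_fun setT F ->
  measurable_fun setT (fun z : R * R => (F z * q (sqn z))%:E).
Proof.
move=> mF; apply/measurable_EFinP; apply: measurable_funM => //.
exact: measurable_qsqn.
Qed.

Lemma integral_rotq g F : g.1 ^+ 2 + g.2 ^+ 2 = 1 -> measurable_fun setT F ->
  (\int[mu2]_z (F (rotz g z) * q (sqn z))%:E = \int[mu2]_z (F z * q (sqn z))%:E)%E.
Proof.
move=> g1 mF; rewrite -(integral_rot g1 (measurable_EFinq mF)).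
by apply: eq_integral => z _; rewrite [in RHS]/sqn sqr_norm_rotz g1 mul1r.
Qed.

Lemma Ex_rot g F : g.1 ^+ 2 + g.2 ^+ 2 = 1 -> measurable_fun setT F ->
  Ex (fun z => F (rotz g z)) = Ex F.
Proof. by move=> g1 mF; rewrite /Ex integral_rotq. Qed.

Definition opp2 (z : R * R) : R * R := (- z.1, - z.2).

Lemma opp2E : opp2 = rotz (-1, 0).
Proof. by apply/funext => z; rewrite /opp2 /rotz /=; congr pair; ring. Qed.

(** [F] is only constant on rays. Adding its value at the opposite point makes it constant on
    punctured lines, as [integral_polar] requires, and invariance under the half turn accounts for
    the factor 2. *)
Lemma integral_cone F (j : nat) : measurable_fun setT F -> (forall z, 0 <= F z) ->
  (forall (r : R) z, 0 < r -> F (r * z.1, r * z.2) = F z) ->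
  (2%:E * \int[mu2]_z (F z * rho z ^+ j * q (sqn z))%:E =
    moment j * \int[mu]_t ((F (1, t)%R + F (-1, - t)%R) / (1 + t ^+ 2))%:E)%E.
Proof.
move=> mF F0 hF.
have g1 : (-1 : R) ^+ 2 + 0 ^+ 2 = 1 by ring.
pose w z := F z + F (opp2 z).
have mw : measurable_fun setT w.
  apply: measurable_funD => //; rewrite opp2E.
  by apply: measurableT_comp => //; exact: measurable_rotz.
have w0 z : 0 <= w z by rewrite addr_ge0.
have hw (r : R) z : r != 0 -> w (r * z.1, r * z.2) = w z.
  rewrite /w /opp2 /= => r0; have [rlt0|rgt0|r00] := ltgtP r 0; last by rewrite r00 eqxx in r0.
  - rewrite addrC -!mulNr (hF (- r)); last lra.
    congr (_ + _); rewrite -[RHS](hF (- r)); last lra.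
    by congr F; congr pair => /=; ring.
  - rewrite hF//; congr (_ + _); rewrite -[RHS](hF r)//.
    by congr F; congr pair => /=; ring.
rewrite -(@integral_polar _ w q j)//.
pose H z := F z * rho z ^+ j.
have mrho : measurable_fun setT (fun z => rho z ^+ j).
  by apply: measurable_funX; exact: measurable_norm2.
have mH : measurable_fun setT H by exact: measurable_funM.
have H0 z : 0 <= H z by rewrite mulr_ge0// exprn_ge0// sqrtr_ge0.
have -> : (\int[mu2]_z (w z * Num.sqrt (sqn z) ^+ j * q (sqn z))%:E =
   \int[mu2]_z ((H z * q (sqn z))%:E + (H (rotz (-1, 0)%R z) * q (sqn z))%:E))%E.
  apply: eq_integral => z _; rewrite -EFinD; congr (_%:E).
  have E : rho (opp2 z) = rho z by rewrite /rho /sqn /opp2 /= !sqrrN.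
  by rewrite /H /w -opp2E E -/(rho z); ring.
rewrite ge0_integralD//.
- rewrite (integral_rotq (g := (-1, 0)) g1 mH) -/H.
  by rewrite (_ : 2 = 1 + 1)%R// EFinD ge0_muleDl// ?mul1e.
- by move=> z _; rewrite lee_fin mulr_ge0.
- exact: measurable_EFinq.
- by move=> z _; rewrite lee_fin mulr_ge0.
- apply: (measurable_EFinq (F := fun z => H (rotz (-1, 0) z))).
  by apply: measurableT_comp => //; exact: measurable_rotz.
Qed.

End radial.

(** * Expectations under a radial density *)

Section radial_expectation.
Context {R : realType}.
Local Notation mu := (@lebesgue_measure R).
Local Notation mu2 := ((@lebesgue_measure R) \x (@lebesgue_measure R))%E.
Variables (q : R -> R).
Hypothesis mq : measurable_fun setT q.
Hypothesis q0 : forall t, 0 <= q t.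
Hypothesis moment_fin : forall j, (j <= 2)%N -> moment q j \is a fin_num.
Hypothesis moment_gt0 : forall j, (j <= 1)%N -> (0 < moment q j)%E.
Implicit Types (F G : R * R -> R) (A : set (R * R)).
Local Notation Ex := (Ex q).

Lemma measurable_inv : measurable_fun setT (@GRing.inv R).
Proof.
have mD : measurable ([set~ 0] : set R) by exact: measurableC.
rewrite -(setUv [set (0:R)]); apply/measurable_funU => //; split.
  exact: measurable_fun_set1.
apply: open_continuous_measurable_fun; first by apply: closed_openC; exact: closed_eq.
by move=> x; rewrite inE /= => /eqP x0; exact: inv_continuous.
Qed.

(* Half of [moment q j], so that [Ex (\1_A * rho ^ j) = mom j * Theta A] with [Theta A] in
   radians. *)
Definition mom (j : nat) : R := fine (moment q j) / 2.

Lemma mom_gt0 j : (j <= 1)%N -> 0 < mom j.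
Proof.
move=> j1; rewrite divr_gt0// fine_gt0// moment_gt0//= -ge0_fin_numE.
  by apply: moment_fin; exact: leq_trans j1 _.
by exact/ltW/moment_gt0.
Qed.

(** A class of integrands made integrable by the finite moments up to order 2 and stable under the
    operations used below. On it the [fine] in [Ex] loses nothing. *)
Definition quad_growth F := measurable_fun setT F /\ exists k : R, forall z, `|F z| <= k * (1 + sqn z).

Lemma rho_ge0 (z : R * R) : 0 <= rho z. Proof. exact: sqrtr_ge0. Qed.

Lemma rho2 (z : R * R) : rho z ^+ 2 = sqn z.
Proof. by rewrite /rho sqr_sqrtr// sqn_ge0. Qed.

Lemma integral_rhoX (j : nat) : (j <= 2)%N ->
  (\int[mu2]_z (rho z ^+ j * q (sqn z))%:E < +oo)%E.
Proof.
move=> j2.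
have := @integral_polar R (cst 1) q j (@measurable_cst _ _ _ _ _ _) (fun=> ler01) (fun r z _ => erefl) mq q0.
under eq_integral do rewrite mul1r; move=> ->.
under [X in (_ * X)%E]eq_integral do rewrite mul1r.
rewrite integralT_oneDsqrV -ge0_fin_numE ?fin_numM//; first exact: moment_fin.
rewrite mule_ge0// ?lee_fin ?pi_ge0// integral_ge0// => x _.
by rewrite lee_fin mulr_ge0// exprn_ge0.
Qed.

Lemma quad_growth_integrable F : quad_growth F ->
  mu2.-integrable setT (fun z => (F z * q (sqn z))%:E).
Proof.
move=> [mF [k Fk]].
have mdom : measurable_fun setT (fun z : R * R => 1 + sqn z).
  by apply: measurable_funD => //; exact: measurable_sqn.
apply: (@le_integrable _ _ _ mu2 _ measurableT _ (fun z => k%:E * ((1 + sqn z) * q (sqn z))%:E)%E).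
- exact: measurable_EFinq.
- move=> z _; rewrite -EFinM !abse_EFin lee_fin mulrA (normrM (F z)) (normrM (k * _)).
  apply: ler_wpM2r => //; apply: le_trans (Fk z) _; exact: ler_norm.
apply: integrableZl => //.
apply/integrableP; split; first exact: measurable_EFinq.
under eq_integral => z _.
  rewrite abse_EFin ger0_norm; last by rewrite mulr_ge0// addr_ge0// sqn_ge0.
  rewrite mulrDl EFinD -[in X in (X + _)%E](expr0 (rho z)) -[in X in (_ + (X * _)%:E)%E]rho2.
  over.
rewrite ge0_integralD//.
- by rewrite lte_add_pinfty// integral_rhoX.
- by move=> z _; rewrite lee_fin mulr_ge0// exprn_ge0// rho_ge0.
- by apply: measurable_EFinq => //; apply: measurable_funX; exact: measurable_norm2.
- by move=> z _; rewrite lee_fin mulr_ge0// exprn_ge0// rho_ge0.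
- by apply: measurable_EFinq => //; apply: measurable_funX; exact: measurable_norm2.
Qed.

Lemma quad_growth_fin F : quad_growth F -> (\int[mu2]_z (F z * q (sqn z))%:E = (Ex F)%:E)%E.
Proof. by move=> gF; rewrite fineK//; apply: integrable_fin_num => //; exact: quad_growth_integrable. Qed.

Lemma quad_growthD F G : quad_growth F -> quad_growth G -> quad_growth (fun z => F z + G z).
Proof.
move=> [mF [k Fk]] [mG [l Gl]]; split; first exact: measurable_funD.
exists (k + l) => z; rewrite mulrDl; apply: le_trans (ler_normD _ _) _.
exact: lerD.
Qed.

Lemma quad_growthZ (a : R) F : quad_growth F -> quad_growth (fun z => a * F z).
Proof.
move=> [mF [k Fk]]; split; first exact: measurable_funM.
exists (`|a| * k) => z; rewrite normrM -mulrA; exact: ler_wpM2l.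
Qed.

Lemma quad_growth_sum (I : Type) (s : seq I) (F : I -> R * R -> R) :
  (forall i, quad_growth (F i)) -> quad_growth (fun z => \sum_(i <- s) F i z).
Proof.
move=> gF; elim: s => [|i s ih].
  under eq_fun do rewrite big_nil.
  by split => //; exists 0 => z; rewrite normr0 mul0r.
under eq_fun do rewrite big_cons.
exact: quad_growthD.
Qed.

Lemma quad_growth_dom F G : measurable_fun setT F -> quad_growth G -> (forall z, `|F z| <= `|G z|) -> quad_growth F.
Proof. by move=> mF [mG [k Gk]] FG; split => //; exists k => z; exact: le_trans (FG z) _. Qed.

Lemma quad_growth_indic A F : measurable A -> quad_growth F -> quad_growth (fun z => \1_A z * F z).
Proof.
move=> mA gF; apply: (quad_growth_dom _ gF).
  by apply: measurable_funM; [exact: measurable_indic|case: gF].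
move=> z; rewrite normrM ler_piMl// indicE; case: (_ \in _); rewrite ?normr1 ?normr0//.
Qed.

Lemma quad_growth_cst (a : R) : quad_growth (fun=> a).
Proof.
split => //; exists `|a| => z; rewrite ler_peMr// lerDl; exact: sqn_ge0.
Qed.

Lemma quad_growth_sqn : quad_growth sqn.
Proof.
split; first exact: measurable_sqn.
by exists 1 => z; rewrite ger0_norm ?sqn_ge0// mul1r lerDr.
Qed.

Lemma quad_growth_rho : quad_growth rho.
Proof.
split; first exact: measurable_norm2.
exists 1 => z; rewrite mul1r ger0_norm ?rho_ge0// -rho2.
have := sqr_ge0 (rho z - 1); have := rho_ge0 z; nra.
Qed.

Lemma quad_growth_rhoX j : (j <= 2)%N -> quad_growth (fun z => rho z ^+ j).
Proof.
case: j => [|[|[|//]]] _; first exact: quad_growth_cst.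
  by under eq_fun do rewrite expr1; exact: quad_growth_rho.
by under eq_fun do rewrite rho2; exact: quad_growth_sqn.
Qed.

Lemma norm_fst_le (z : R * R) : `|z.1| <= rho z.
Proof. by rewrite -sqrtr_sqr ler_wsqrtr// lerDl sqr_ge0. Qed.

Lemma norm_snd_le (z : R * R) : `|z.2| <= rho z.
Proof. by rewrite -sqrtr_sqr ler_wsqrtr// lerDr sqr_ge0. Qed.

Lemma quad_growth_fst : quad_growth fst.
Proof.
apply: (quad_growth_dom _ quad_growth_rho) => // z; rewrite [leRHS]ger0_norm ?rho_ge0//; exact: norm_fst_le.
Qed.

Lemma quad_growth_snd : quad_growth snd.
Proof.
apply: (quad_growth_dom _ quad_growth_rho) => // z; rewrite [leRHS]ger0_norm ?rho_ge0//; exact: norm_snd_le.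
Qed.

Lemma quad_growth_rotz g F : g.1 ^+ 2 + g.2 ^+ 2 = 1 -> quad_growth F -> quad_growth (fun z => F (rotz g z)).
Proof.
move=> g1 [mF [k Fk]]; split; first by apply: measurableT_comp => //; exact: measurable_rotz.
by exists k => z; apply: le_trans (Fk _) _; rewrite [in leLHS]/sqn sqr_norm_rotz g1 mul1r.
Qed.

Lemma ExD F G : quad_growth F -> quad_growth G -> Ex (fun z => F z + G z) = Ex F + Ex G.
Proof.
move=> gF gG; apply: EFin_inj; rewrite EFinD -!quad_growth_fin//; last exact: quad_growthD.
rewrite -integralD//; [|exact: quad_growth_integrable..].
by apply: eq_integral => z _; rewrite mulrDl EFinD.
Qed.

Lemma ExZ (a : R) F : quad_growth F -> Ex (fun z => a * F z) = a * Ex F.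
Proof.
move=> gF; apply: EFin_inj; rewrite EFinM -!quad_growth_fin//; last exact: quad_growthZ.
rewrite -integralZl//; last exact: quad_growth_integrable.
by apply: eq_integral => z _; rewrite -mulrA EFinM.
Qed.

Lemma ExB F G : quad_growth F -> quad_growth G -> Ex (fun z => F z - G z) = Ex F - Ex G.
Proof.
move=> gF gG; under eq_fun do rewrite -mulN1r.
by rewrite ExD ?ExZ ?mulN1r//; exact: quad_growthZ.
Qed.

Lemma Ex_le F G : quad_growth F -> quad_growth G -> (forall z, F z <= G z) -> Ex F <= Ex G.
Proof.
move=> gF gG FG; rewrite -lee_fin -!quad_growth_fin//; apply: le_integral => //.
- exact: quad_growth_integrable.
- exact: quad_growth_integrable.
by move=> z _; rewrite lee_fin ler_wpM2r.
Qed.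

Lemma Ex_ge0 F : (forall z, 0 <= F z) -> 0 <= Ex F.
Proof. by move=> F0; rewrite fine_ge0// integral_ge0// => z _; rewrite lee_fin mulr_ge0. Qed.

Lemma Ex_sum (I : Type) (s : seq I) (F : I -> R * R -> R) :
  (forall i, quad_growth (F i)) -> Ex (fun z => \sum_(i <- s) F i z) = \sum_(i <- s) Ex (F i).
Proof.
move=> gF; elim: s => [|i s ih].
  rewrite big_nil; under eq_fun do rewrite big_nil.
  by have := ExZ 0 (quad_growth_cst 0); rewrite !mul0r.
rewrite big_cons -ih -ExD//; last exact: quad_growth_sum.
by congr Ex; apply/funext => z; rewrite big_cons.
Qed.

(** General weights of degree zero are allowed besides indicators, so that the cosine of the
    argument on a sector is covered in [Ex_sector_fst]. *)
Lemma Ex_cone F (j : nat) (T : R) : measurable_fun setT F -> (forall z, 0 <= F z <= 1) ->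
  (forall (r : R) z, 0 < r -> F (r * z.1, r * z.2) = F z) -> (j <= 2)%N ->
  (\int[mu]_t ((F (1, t)%R + F (-1, - t)%R) / (1 + t ^+ 2))%:E = T%:E)%E ->
  Ex (fun z => F z * rho z ^+ j) = mom j * T.
Proof.
move=> mF F01 hF j2 ET.
have F0 z : 0 <= F z by case/andP: (F01 z).
have := integral_cone mq q0 j mF F0 hF; rewrite ET.
have gF : quad_growth (fun z => F z * rho z ^+ j).
  apply: (quad_growth_dom _ (quad_growth_rhoX j2)); first apply: measurable_funM => //.
    by apply: measurable_funX; exact: measurable_norm2.
  move=> z; rewrite normrM ler_piMl// ger0_norm//; by case/andP: (F01 z).
rewrite (quad_growth_fin gF) -[moment q j]fineK; last exact: moment_fin.
rewrite -!EFinM => -[]; rewrite /mom; lra.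
Qed.

Definition cone A := forall (r : R) z, 0 < r -> A (r * z.1, r * z.2) <-> A z.

(* The angle [T] subtended by [A]: [t = y / x] parametrizes each of the half planes [x > 0]
   and [x < 0]. *)
Definition Theta A : R :=
  fine (\int[mu]_t ((\1_A (1, t)%R + \1_A (-1, - t)%R) / (1 + t ^+ 2))%:E)%E.

Lemma indic01 A z : (0 : R) <= \1_A z <= (1 : R).
Proof. by rewrite indicE; case: (_ \in _); rewrite ?lexx ?ler01. Qed.

Lemma Theta_fin A : measurable A ->
  (\int[mu]_t ((\1_A (1, t)%R + \1_A (-1, - t)%R) / (1 + t ^+ 2))%:E = (Theta A)%:E)%E.
Proof.
move=> mA; rewrite fineK//.
have mI : measurable_fun setT (\1_A : R * R -> R) by exact: measurable_indic.
have m1 : measurable_fun setT (fun t : R => (1 + t ^+ 2)^-1).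
  apply: continuous_measurable_fun; exact: continuous_oneDsqrV.
rewrite ge0_fin_numE; last first.
  apply: integral_ge0 => t _; rewrite lee_fin divr_ge0//.
  by rewrite addr_ge0// sqr_ge0.
apply: (@le_lt_trans _ _ (\int[mu]_t (2%:E * ((1 + t ^+ 2)^-1)%:E))%E).
  apply: ge0_le_integral => //.
  - move=> t _; rewrite lee_fin divr_ge0//.
    by rewrite addr_ge0// sqr_ge0.
  - apply/measurable_EFinP; apply: measurable_funM => //.
    apply: measurable_funD; apply: (measurableT_comp mI); apply: measurable_fun_pair => //.
  - by apply: measurable_funeM; exact/measurable_EFinP.
  - move=> t _; rewrite -EFinM lee_fin ler_wpM2r//.
      by rewrite invr_ge0 addr_ge0// sqr_ge0.
    by have /andP[_ ?] := indic01 A (1, t); have /andP[_ ?] := indic01 A (-1, -t); lra.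
rewrite ge0_integralZl//; last 2 first.
- exact/measurable_EFinP.
- by move=> t _; rewrite lee_fin invr_ge0 addr_ge0// sqr_ge0.
by rewrite integralT_oneDsqrV -EFinM ltry.
Qed.

Lemma cone_indic A (r : R) z : cone A -> 0 < r -> \1_A (r * z.1, r * z.2) = \1_A z :> R.
Proof.
move=> cA r0; rewrite !indicE; congr (_ %:R); apply: congr1.
by apply/idP/idP; rewrite !inE => /(cA _ _ r0).
Qed.

Lemma Ex_cone_indic A j : measurable A -> cone A -> (j <= 2)%N ->
  Ex (fun z => \1_A z * rho z ^+ j) = mom j * Theta A.
Proof.
move=> mA cA j2; apply: Ex_cone => //.
- exact: indic01.
- by move=> r z; exact: cone_indic.
- exact: Theta_fin.
Qed.

Lemma Theta_setT : Theta setT = 2 * pi.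
Proof.
rewrite /Theta; under eq_integral do rewrite !indicE !in_setT /= EFinM.
rewrite ge0_integralZl//; last 2 first.
- apply/measurable_EFinP; apply: continuous_measurable_fun; exact: continuous_oneDsqrV.
- by move=> t _; rewrite lee_fin invr_ge0 addr_ge0// sqr_ge0.
by rewrite integralT_oneDsqrV -EFinM.
Qed.

Lemma Theta_ge0 A : 0 <= Theta A.
Proof.
rewrite fine_ge0// integral_ge0// => t _; rewrite lee_fin divr_ge0//.
by rewrite addr_ge0// sqr_ge0.
Qed.

(** For d in [0, pi], the points whose argument is at most d in absolute value, together with the
    origin. *)
Definition sector (d : R) : set (R * R) := [set z | cos d * rho z <= z.1].

Lemma measurable_sector (d : R) : measurable (sector d).
Proof.
rewrite -[sector d]setTI; apply: measurable_fun_le => //.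
by apply: measurable_funM => //; exact: measurable_norm2.
Qed.

Lemma cone_sector (d : R) : cone (sector d).
Proof.
move=> r z r0; rewrite /sector /= rho_scale gtr0_norm// mulrCA ler_pM2l//.
Qed.

Lemma indic_sector (d t : R) : 0 < d < pi / 2 ->
  \1_(sector d) (1, t) = \1_(`[- tan d, tan d]%classic) t :> R.
Proof.
move=> d0; have c0 : 0 < cos d by apply: cos_gt0_pihalf; lra.
have td : 0 < tan d by rewrite divr_gt0 ?sin_gt0_pihalf.
rewrite !indicE; congr (_ %:R); apply: congr1; apply/idP/idP; rewrite !inE /sector /= in_itv /=.
- rewrite -ler_norml -ler_pdivlMl// mulr1 => H.
  have : rho (1, t) ^+ 2 <= (cos d)^-1 ^+ 2 by rewrite ler_sqr ?nnegrE ?rho_ge0 ?invr_ge0 ?(ltW c0).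
  rewrite rho2 /sqn /= expr1n exprVn cos2_tan2; last by rewrite gt_eqF.
  by rewrite lerD2l => H2; rewrite -ler_sqr ?nnegrE ?(ltW td)// real_normK ?num_real.
- rewrite -ler_norml -ler_pdivlMl// mulr1 => H.
  rewrite -ler_sqr ?nnegrE ?rho_ge0 ?invr_ge0 ?(ltW c0)//.
  rewrite rho2 /sqn /= expr1n exprVn cos2_tan2; last by rewrite gt_eqF.
  by rewrite lerD2l -(@real_normK _ t) ?num_real// ler_sqr ?nnegrE// ltW.
Qed.

Lemma indic_sectorN (d t : R) : 0 < d < pi / 2 -> \1_(sector d) (-1, t) = 0 :> R.
Proof.
move=> d0; have c0 : 0 < cos d by apply: cos_gt0_pihalf; lra.
rewrite indicE memNset// /sector /= => H.
have : 0 <= cos d * rho (-1, t) by rewrite mulr_ge0 ?rho_ge0 ?(ltW c0).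
lra.
Qed.

Lemma Theta_sector (d : R) : 0 < d < pi / 2 -> Theta (sector d) = 2 * d.
Proof.
move=> d0; apply: EFin_inj; rewrite -Theta_fin; last exact: measurable_sector.
rewrite -integral_itv_oneDsqrV// [in RHS]integral_mkcond; apply: eq_integral => t _.
rewrite indic_sector// indic_sectorN// addr0 indicE patchE.
by case: ifP => _; rewrite ?mul1r ?mul0r.
Qed.

Lemma Ex_sector_fst (d : R) : 0 < d < pi / 2 ->
  Ex (fun z => \1_(sector d) z * z.1) = mom 1 * (2 * sin d).
Proof.
move=> d0; have c0 : 0 < cos d by apply: cos_gt0_pihalf; lra.
(* On the sector this is the cosine of the argument; at the origin it is 0 by the convention on
   division. *)
pose F (z : R * R) : R := \1_(sector d) z * (z.1 / rho z).
have E z : F z * rho z ^+ 1 = \1_(sector d) z * z.1.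
  rewrite /F expr1; have [r0|r0] := eqVneq (rho z) 0; last by field.
  have /eqP : `|z.1| = 0 by apply: le_anti; rewrite normr_ge0 andbT -r0 norm_fst_le.
  by rewrite normr_eq0 => /eqP ->; rewrite r0 !(mulr0, mul0r).
rewrite -(@Ex_cone F 1%N)//.
- by congr Ex; apply/funext => z; rewrite E.
- apply: measurable_funM; first by apply: measurable_indic; exact: measurable_sector.
  apply: measurable_funM => //; exact: (measurableT_comp measurable_inv measurable_norm2).
- move=> z; rewrite /F indicE; have [zS|_] := boolP (z \in sector d); last by rewrite mul0r lexx ler01.
  rewrite mul1r; move: zS; rewrite inE /sector /= => zS.
  have [r0|r0] := eqVneq (rho z) 0; first by rewrite r0 invr0 mulr0 lexx ler01.
  have rp : 0 < rho z by rewrite lt_neqAle eq_sym r0 rho_ge0.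
  rewrite divr_ge0 ?rho_ge0//=.
    by rewrite ler_pdivrMr// mul1r; apply: le_trans (ler_norm _) (norm_fst_le _).
  by apply: le_trans zS; rewrite mulr_ge0 ?rho_ge0 ?(ltW c0).
- move=> r z r0; rewrite /F cone_indic//; last exact: cone_sector.
  rewrite rho_scale gtr0_norm//=; congr (_ * _).
  have [->|r1] := eqVneq (rho z) 0; first by rewrite mulr0 invr0 !mulr0.
  by field; rewrite r1 gt_eqF.
- rewrite -integral_itv_cos_atan// [in RHS]integral_mkcond; apply: eq_integral => t _.
  rewrite /F indic_sector// indic_sectorN// mul0r addr0 indicE patchE /rho /sqn /= expr1n.
  by case: ifP => _; rewrite !(mul1r, mul0r).
Qed.

End radial_expectation.

(** * Distortion of cells *)

Section quantization.
Context {R : realType}.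
Variables (q : R -> R).
Hypothesis mq : measurable_fun setT q.
Hypothesis q0 : forall t, 0 <= q t.
Hypothesis moment_fin : forall j, (j <= 2)%N -> moment q j \is a fin_num.
Hypothesis moment_gt0 : forall j, (j <= 1)%N -> (0 < moment q j)%E.
Implicit Types (F G : R * R -> R) (A : set (R * R)) (c g z : R * R).
Local Notation Ex := (Ex q).
Local Notation mom := (mom q).

Let mom0 : 0 < mom 0. Proof. exact: mom_gt0. Qed.
Let mom1 : 0 < mom 1. Proof. exact: mom_gt0. Qed.

(** Measuring representatives in units of [mom 1 / mom 0] leaves, up to this factor, a purely
    angular problem. *)
Definition gain : R := mom 1 ^+ 2 / mom 0.
Local Notation K := gain.

Let K_ge0 : 0 <= K. Proof. by rewrite divr_ge0 ?sqr_ge0 ?ltW. Qed.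

Definition sqd c z : R := (z.1 - c.1) ^+ 2 + (z.2 - c.2) ^+ 2.

Definition dot c z : R := c.1 * z.1 + c.2 * z.2.

Lemma sqdE c z : sqd c z = sqn z + (-2) * dot c z + sqn c.
Proof. by rewrite /sqd /sqn /dot; ring. Qed.

Lemma sqd_ge0 c z : 0 <= sqd c z.
Proof. by rewrite addr_ge0// sqr_ge0. Qed.

Lemma quad_growth_dot c : quad_growth (dot c).
Proof. by apply: quad_growthD; apply: quad_growthZ; [exact: quad_growth_fst|exact: quad_growth_snd]. Qed.

Lemma quad_growth_sqd c : quad_growth (sqd c).
Proof.
rewrite (_ : sqd c = (fun z => sqn z + (-2) * dot c z + sqn c)); last first.
  by apply/funext => z; rewrite sqdE.
apply: quad_growthD; last exact: quad_growth_cst.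
by apply: quad_growthD; [exact: quad_growth_sqn|apply: quad_growthZ; exact: quad_growth_dot].
Qed.

Lemma Ex_indic_rho A : measurable A -> cone A ->
  Ex (fun z => \1_A z * rho z) = mom 1 * Theta A.
Proof.
move=> mA cA; rewrite -(Ex_cone_indic mq q0 moment_fin mA cA (j := 1))//.
Qed.

Lemma Ex_indic A : measurable A -> cone A -> Ex (fun z => \1_A z) = mom 0 * Theta A.
Proof.
move=> mA cA; rewrite -(Ex_cone_indic mq q0 moment_fin mA cA (j := 0))//.
by congr Ex; apply/funext => z; rewrite expr0 mulr1.
Qed.

Lemma quad_growth_indic1 A : measurable A -> quad_growth (\1_A : R * R -> R).
Proof.
move=> mA; have := quad_growth_indic mA (@quad_growth_cst R 1).
by under eq_fun do rewrite mulr1.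
Qed.

(** Only the cross term sees more of [A] than its angle, so bounds on the distortion reduce to
    bounds on this term. *)
Lemma Ex_indic_sqd A c : measurable A -> cone A ->
  Ex (fun z => \1_A z * sqd c z) =
  mom 2 * Theta A - 2 * Ex (fun z => \1_A z * dot c z) + sqn c * (mom 0 * Theta A).
Proof.
move=> mA cA; rewrite (_ : (fun z => _) = (fun z =>
    \1_A z * sqn z + (-2) * (\1_A z * dot c z) + sqn c * \1_A z)); last first.
  by apply/funext => z; rewrite sqdE; ring.
have g1 : quad_growth (fun z => \1_A z * sqn z) by apply: quad_growth_indic => //; exact: quad_growth_sqn.
have g2 : quad_growth (fun z => \1_A z * dot c z) by apply: quad_growth_indic => //; exact: quad_growth_dot.
have g3 := quad_growth_indic1 mA.
rewrite !(ExD mq q0 moment_fin)//; last 3 first.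
- exact: quad_growthZ.
- by apply: quad_growthD => //; exact: quad_growthZ.
- exact: quad_growthZ.
rewrite !(ExZ mq q0 moment_fin)// Ex_indic// mulNr; congr (_ - _ + _).
rewrite -(Ex_cone_indic mq q0 moment_fin mA cA (j := 2))//.
by congr Ex; apply/funext => z; rewrite rho2.
Qed.

Lemma dot_rotz g z : dot g z = (rotz (g.1, - g.2) z).1.
Proof. by rewrite /dot /rotz /=; ring. Qed.

Lemma rho_rotz g z : g.1 ^+ 2 + g.2 ^+ 2 = 1 -> rho (rotz g z) = rho z.
Proof. by move=> g1; rewrite /rho [in LHS]/sqn sqr_norm_rotz g1 mul1r. Qed.

Lemma conj_unit g : g.1 ^+ 2 + g.2 ^+ 2 = 1 -> (g.1, - g.2).1 ^+ 2 + (g.1, - g.2).2 ^+ 2 = 1.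
Proof. by rewrite /= sqrrN. Qed.

Lemma Ex_dot_le_rho A g : measurable A -> cone A -> g.1 ^+ 2 + g.2 ^+ 2 = 1 ->
  Ex (fun z => \1_A z * dot g z) <= mom 1 * Theta A.
Proof.
move=> mA cA g1; rewrite -Ex_indic_rho//.
apply: (Ex_le mq q0 moment_fin).
- by apply: quad_growth_indic => //; exact: quad_growth_dot.
- by apply: quad_growth_indic => //; exact: quad_growth_rho.
move=> z; apply: ler_wpM2l; first by case/andP: (indic01 A z).
rewrite dot_rotz -(rho_rotz z (conj_unit g1)).
exact: le_trans (ler_norm _) (norm_fst_le _).
Qed.

(* Bathtub principle: [g . z - cos d * |z|] is nonnegative exactly on the sector of
   half-angle [d] about [g]. *)
Lemma Ex_dot_bathtub A g (d : R) : measurable A -> cone A -> g.1 ^+ 2 + g.2 ^+ 2 = 1 ->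
  0 < d < pi / 2 ->
  Ex (fun z => \1_A z * dot g z) - cos d * (mom 1 * Theta A) <=
  mom 1 * (2 * sin d - cos d * (2 * d)).
Proof.
move=> mA cA g1 d0; have mS := @measurable_sector R d; have cS := @cone_sector R d.
pose F z := \1_(sector d) z * (z.1 - cos d * rho z).
have gF : quad_growth F.
  apply: quad_growth_indic => //; under eq_fun do rewrite -mulNr.
  by apply: quad_growthD; [exact: quad_growth_fst|apply: quad_growthZ; exact: quad_growth_rho].
have gd : quad_growth (fun z => \1_A z * dot g z) by apply: quad_growth_indic => //; exact: quad_growth_dot.
have gr : quad_growth (fun z => \1_A z * rho z) by apply: quad_growth_indic => //; exact: quad_growth_rho.
(* The right side is the value of the same functional on the optimal set, the sector rotated to the
   axis [g]. *)
have -> : mom 1 * (2 * sin d - cos d * (2 * d)) = Ex (fun z => F (rotz (g.1, - g.2) z)).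
  rewrite (Ex_rot mq (conj_unit g1)); last by case: gF.
  rewrite /F; under eq_fun do rewrite mulrBr mulrCA.
  rewrite (ExB mq q0 moment_fin); last 2 first.
  - by apply: quad_growth_indic => //; exact: quad_growth_fst.
  - by apply: quad_growthZ; apply: quad_growth_indic => //; exact: quad_growth_rho.
  rewrite (ExZ mq q0 moment_fin); last by apply: quad_growth_indic => //; exact: quad_growth_rho.
  by rewrite (Ex_sector_fst mq q0 moment_fin)// Ex_indic_rho// Theta_sector//; ring.
rewrite -Ex_indic_rho// -(ExZ mq q0 moment_fin)// -(ExB mq q0 moment_fin)//; last exact: quad_growthZ.
apply: (Ex_le mq q0 moment_fin).
- under eq_fun do rewrite -mulNr; apply: quad_growthD => //; exact: quad_growthZ.
- exact: quad_growth_rotz (conj_unit g1) gF.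
move=> z; rewrite /F dot_rotz rho_rotz; last exact: conj_unit.
rewrite -(rho_rotz z (conj_unit g1)); set y := rotz _ z.
rewrite mulrCA -mulrBr [in leRHS]indicE; have [yS|yS] := boolP (y \in sector d).
  rewrite mul1r ler_piMl//.
  by move: yS; rewrite inE /sector /= subr_ge0.
rewrite mul0r mulr_ge0_le0//.
by move: yS; rewrite notin_setE /sector /= => /negP; rewrite -ltNge subr_le0 => /ltW.
Qed.

(** The slope of the tangent acts as a Lagrange multiplier for the angle of [A]. For a given length
    of [c], the penalized problem is solved by a sector whose half-angle has cosine [tau], and
    [bathtub_gap] evaluates it. *)
Lemma cell_bound A c (u : R) : measurable A -> cone A -> 0 < u <= pi / 2 ->
  (mom 2 - K * chord_slope u) * Theta A - K * chord_icept u <=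
  Ex (fun z => \1_A z * sqd c z).
Proof.
move=> mA cA u0; rewrite Ex_indic_sqd//.
have pi2 := @pi_ge2 R.
have al0 := chord_slope_ge0 u0.
have be0 : 0 <= chord_icept u by apply: chord_icept_ge0; lra.
have T0 := @Theta_ge0 R A.
have [c0|cn0] := eqVneq (rho c) 0.
  have [c1 c2] : c.1 = 0 /\ c.2 = 0.
    have /eqP : sqn c = 0 by rewrite -rho2 c0 expr0n.
    by rewrite paddr_eq0 ?sqr_ge0// !sqrf_eq0 => /andP[/eqP ? /eqP ?].
  rewrite (_ : (fun z => _) = (fun z => 0 * \1_A z)); last first.
    by apply/funext => z; rewrite /dot c1 c2; ring.
  rewrite (ExZ mq q0 moment_fin); last exact: quad_growth_indic1.
  rewrite /sqn c1 c2.
  have := mulr_ge0 (mulr_ge0 K_ge0 al0) T0; have := mulr_ge0 K_ge0 be0.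
  by rewrite mulrBl; lra.
have n0 : 0 < rho c by rewrite lt_neqAle eq_sym cn0 rho_ge0.
pose g := (c.1 / rho c, c.2 / rho c).
have g1 : g.1 ^+ 2 + g.2 ^+ 2 = 1.
  by rewrite /g /= !exprMn -mulrDl -/(sqn c) -rho2 exprVn divff// sqrf_eq0.
(* [r] and [m] are the length of [c] and the first moment along [c] in normalized units; [gain] then
   factors out of the claim. *)
pose r := rho c * mom 0 / mom 1.
pose m := Ex (fun z => \1_A z * dot g z) / mom 1.
have r0 : 0 < r by rewrite divr_gt0// mulr_gt0.
have Em : Ex (fun z => \1_A z * dot c z) = rho c * (mom 1 * m).
  have -> : mom 1 * m = Ex (fun z => \1_A z * dot g z) by rewrite /m; field; rewrite gt_eqF.
  rewrite -(ExZ mq q0 moment_fin); last by apply: quad_growth_indic => //; exact: quad_growth_dot.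
  by congr Ex; apply/funext => z; rewrite /dot /g /=; field.
suff H : - chord_slope u * Theta A - chord_icept u <= - 2 * r * m + r ^+ 2 * Theta A.
  have {H} := ler_wpM2l K_ge0 H.
  have -> : K * (- 2 * r * m + r ^+ 2 * Theta A) =
    - 2 * (rho c * (mom 1 * m)) + rho c ^+ 2 * (mom 0 * Theta A).
    by rewrite /gain /r; field; rewrite !gt_eqF.
  by rewrite Em -rho2; lra.
(* This ratio is the bathtub threshold. If it is at least 1 no direction pays off, and the trivial
   bound [m <= Theta A] suffices; otherwise it is the cosine of a half-angle. *)
have [tau1|tau1] := leP 1 ((r ^+ 2 + chord_slope u) / (2 * r)).
  have H2 : 2 * r <= r ^+ 2 + chord_slope u.
    by move: tau1; rewrite ler_pdivlMr ?mul1r// mulr_gt0.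
  have mT : m <= Theta A.
    by rewrite /m ler_pdivrMr// mulrC; exact: Ex_dot_le_rho.
  have := ler_wpM2l (ltW r0) mT.
  have := ler_wpM2r T0 H2.
  lra.
set tau := _ / _ in tau1.
have tau0 : 0 < tau.
  by apply: divr_gt0; [apply: ltr_pwDl => //; exact: exprn_gt0|exact: mulr_gt0].
pose d := acos tau.
have cd : cos d = tau by rewrite /d acosK// in_itv /=; lra.
have d0 : 0 < d < pi / 2.
  rewrite acos_gt0 /=; last lra.
  rewrite ltNge; apply/negP => dge.
  have : cos d <= cos (pi / 2).
    apply: cos_antitone => //; first by rewrite divr_ge0// pi_ge0.
    by apply: acos_lepi; lra.
  by rewrite cos_pihalf cd; lra.
have := Ex_dot_bathtub mA cA g1 d0.
have -> : Ex (fun z => \1_A z * dot g z) = mom 1 * m by rewrite /m; field; rewrite gt_eqF.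
rewrite cd (mulrCA tau) -mulrBr ler_pM2l// => mtau.
have Et : 2 * r * tau = r ^+ 2 + chord_slope u.
  by rewrite /tau; field; rewrite gt_eqF.
have gap : 4 * r * sin d - (r ^+ 2 + chord_slope u) * (2 * d) <= chord_icept u.
  by apply: bathtub_gap => //; lra.
have {mtau} := ler_wpM2l (_ : 0 <= 2 * r) mtau => H.
have {H} := H (mulr_ge0 (ler0n _ 2) (ltW r0)).
have -> : 2 * r * (m - tau * Theta A) = 2 * r * m - (2 * r * tau) * Theta A by ring.
have -> : 2 * r * (2 * sin d - tau * (2 * d)) = 4 * r * sin d - (2 * r * tau) * (2 * d) by ring.
rewrite Et; lra.
Qed.

Definition fiber (I : Type) (l : R * R -> I) (i : I) : set (R * R) := [set z | l z = i].

Lemma sum_fiber (I : finType) (l : R * R -> I) (f : I -> R) z :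
  \sum_i \1_(fiber l i) z * f i = f (l z).
Proof.
rewrite (bigD1 (l z))//= indicE mem_set// mul1r big1 ?addr0// => i il.
by rewrite indicE memNset ?mul0r// /fiber /= => E; rewrite E eqxx in il.
Qed.

Lemma quad_growth_fiber (I : finType) (l : R * R -> I) (f : I -> R * R -> R) :
  (forall i, measurable (fiber l i)) -> (forall i, quad_growth (f i)) ->
  quad_growth (fun z => f (l z) z).
Proof.
move=> ml gf; under eq_fun => z do rewrite -(sum_fiber l (fun i => f i z)).
by apply: quad_growth_sum => i; exact: quad_growth_indic.
Qed.

Lemma Ex_fiber (I : finType) (l : R * R -> I) (f : I -> R * R -> R) :
  (forall i, measurable (fiber l i)) -> (forall i, quad_growth (f i)) ->
  Ex (fun z => f (l z) z) = \sum_i Ex (fun z => \1_(fiber l i) z * f i z).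
Proof.
move=> ml gf; rewrite -(Ex_sum mq q0 moment_fin); last by move=> i; exact: quad_growth_indic.
by congr Ex; apply/funext => z; rewrite (sum_fiber l (fun i => f i z)).
Qed.

(** Summing [cell_bound] costs one intercept per cell. Cells of angle zero are bounded below by 0
    instead, so only the others have to be counted. *)
Lemma quantizer_ge (I : finType) (l : R * R -> I) (c : I -> R * R) (u : R) (N : nat) :
  (forall i, measurable (fiber l i)) -> (forall i, cone (fiber l i)) ->
  0 < u <= pi / 2 -> (#|[pred i | Theta (fiber l i) != 0%R]| <= N)%N ->
  (mom 2 - K * chord_slope u) * (2 * pi) - N%:R * (K * chord_icept u) <=
  Ex (fun z => sqd (c (l z)) z).
Proof.
move=> ml cl u0 cardN.
have Kb : 0 <= K * chord_icept u.
  by rewrite mulr_ge0// chord_icept_ge0//; have := @pi_ge2 R; lra.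
(* Additivity of the angle is read off from that of [Ex] on indicators, after multiplication by
   [mom 0]. *)
have ET : \sum_i Theta (fiber l i) = 2 * pi.
  apply: (mulfI (lt0r_neq0 mom0)); rewrite mulr_sumr -Theta_setT -Ex_indic//.
  rewrite (_ : Ex _ = Ex (fun=> 1)); last by congr Ex; apply/funext => z; rewrite indicE in_setT.
  rewrite (Ex_fiber ml (fun=> @quad_growth_cst R 1)).
  by apply: eq_bigr => i _; rewrite -Ex_indic//; congr Ex; apply/funext => z; rewrite mulr1.
rewrite (Ex_fiber (f := fun i => sqd (c i)))//; last by move=> i; exact: quad_growth_sqd.
apply: (@le_trans _ _ (\sum_i ((mom 2 - K * chord_slope u) * Theta (fiber l i)
   - (Theta (fiber l i) != 0)%:R * (K * chord_icept u)))).
  rewrite big_split /= -mulr_sumr ET lerD2l sumrN lerN2 -mulr_suml ler_wpM2r//.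
  rewrite -natr_sum ler_nat (leq_trans _ cardN)// -sum1_card [leqRHS]big_mkcond.
  by apply: leq_sum => i _; rewrite inE; case: (_ != _).
apply: ler_sum => i _; have [T0|T0] := eqVneq (Theta (fiber l i)) 0; last first.
  by rewrite mul1r; exact: cell_bound.
rewrite T0 mulr0 mul0r subr0; apply: (Ex_ge0 q0) => z.
by rewrite mulr_ge0 ?sqd_ge0//; case/andP: (indic01 (fiber l i) z).
Qed.

(** Distance from the origin to the center of mass of a sector of angle u: its first moment
    [mom 1 * (2 * sin (u / 2))] over its mass [mom 0 * u]. *)
Definition centroid (u : R) : R := mom 1 / mom 0 * (sin (u / 2) / (u / 2)).

(** The equality case of [cell_bound]: at its point of tangency the tangent takes the value
    [chord u]. *)
Lemma sector_distortion g (u : R) : 0 < u < pi -> g.1 ^+ 2 + g.2 ^+ 2 = 1 ->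
  Ex (fun z => \1_(sector (u / 2)) (rotz (g.1, - g.2) z) *
    sqd (centroid u * g.1, centroid u * g.2) z) =
  (mom 2 - K * chord_slope u) * u - K * chord_icept u.
Proof.
move=> u0 g1; set t := centroid u; pose d := u / 2.
have d0 : 0 < d < pi / 2 by rewrite /d; lra.
have mS := @measurable_sector R d; have cS := @cone_sector R d.
pose F z := \1_(sector d) z * sqd (t, 0) z.
have gF : quad_growth F by apply: quad_growth_indic => //; exact: quad_growth_sqd.
rewrite (_ : (fun z => _) = (fun z => F (rotz (g.1, - g.2) z))); last first.
  apply/funext => z; rewrite /F -/d; congr (_ * _); rewrite !sqdE.
  have -> : sqn (rotz (g.1, - g.2) z) = sqn z.
    by rewrite [LHS]sqr_norm_rotz /= sqrrN g1 mul1r.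
  rewrite /sqn /dot /rotz /= !exprMn -mulrDr g1; ring.
rewrite (Ex_rot mq (conj_unit g1)); last by case: gF.
rewrite Ex_indic_sqd// Theta_sector//.
rewrite (_ : (fun z => \1_(sector d) z * dot (t, 0) z) =
  (fun z => t * (\1_(sector d) z * z.1))); last first.
  by apply/funext => z; rewrite /dot /=; ring.
rewrite (ExZ mq q0 moment_fin); last by apply: quad_growth_indic => //; exact: quad_growth_fst.
rewrite (Ex_sector_fst mq q0 moment_fin)//.
have un0 : u != 0 by rewrite gt_eqF//; lra.
have -> : (mom 2 - K * chord_slope u) * u - K * chord_icept u = mom 2 * u - K * chord u.
  by rewrite /chord_icept; ring.
have -> : chord u = 2 * sin d ^+ 2 / d.
  by rewrite /chord half_angle -/d /d; field.
rewrite /sqn /t /centroid /gain -/d /= (_ : u = 2 * d); last by rewrite /d; field.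
by field; rewrite !gt_eqF//; case/andP: d0.
Qed.

End quantization.

(** * Counting the cells of a line arrangement *)

Section arrangement.
Context {R : realType}.
Implicit Types (L : seq (R * R)) (n z d : R * R).

Definition signs L z : seq bool := [seq 0 <= dot n z | n <- L].

Definition off_lines L z : bool := all (fun n => (n == (0, 0)) || (dot n z != 0)) L.

Lemma dot_comb n z z' (a b : R) :
  dot n (a * z.1 + b * z'.1, a * z.2 + b * z'.2) = a * dot n z + b * dot n z'.
Proof. by rewrite /dot /=; ring. Qed.

Lemma dot_scale n z (a : R) : dot n (a * z.1, a * z.2) = a * dot n z.
Proof. by rewrite /dot /=; ring. Qed.

Lemma signs_scale L z (a : R) : 0 < a -> signs L (a * z.1, a * z.2) = signs L z.
Proof. by move=> a0; apply: eq_map => n; rewrite dot_scale pmulr_rge0. Qed.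

(** The open cells of the arrangement are convex cones. *)
Lemma signs_comb L z z' (a b : R) : 0 < a -> 0 < b ->
  off_lines L z -> off_lines L z' -> signs L z = signs L z' ->
  let p := (a * z.1 + b * z'.1, a * z.2 + b * z'.2) in
  off_lines L p /\ signs L p = signs L z.
Proof.
move=> a0 b0; elim: L => [//|n L ih] /= /andP[oz oL] /andP[oz' oL'] [E EL].
have [ih1 ih2] := ih oL oL' EL; rewrite ih1 ih2 dot_comb andbT.
have [->/=|nn0] := eqVneq n (0, 0).
  by split => //; congr cons; rewrite /dot !mul0r !addr0 !mulr0 addr0 lexx.
move: oz oz' E; rewrite (negbTE nn0) /= => oz oz' E.
case: (ltgtP 0 (dot n z)) oz E => [h|h|//] _; case: (ltgtP 0 (dot n z')) oz' => [h'|h'|//] _ // _.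
- have H : 0 < a * dot n z + b * dot n z' by rewrite addr_gt0// mulr_gt0.
  by rewrite (gt_eqF H) (ltW H).
- have H : a * dot n z + b * dot n z' < 0.
    by rewrite -(addr0 0) ltrD// pmulr_rlt0.
  by rewrite (lt_eqF H) leNgt H.
Qed.

(* A new line through the origin can only split the at most two cells met by its two
   rays [d] and [- d]. *)
Lemma count_signs L : exists S : seq (seq bool),
  (size S <= maxn 1 (2 * size L))%N /\ forall z, off_lines L z -> signs L z \in S.
Proof.
elim: L => [|n L [S [sS HS]]]; first by exists [:: [::]]; split.
have [n0|nn0] := eqVneq n (0, 0).
  exists (map (cons true) S); split; first by rewrite size_map /=; lia.
  move=> z /= /andP[_ oz]; rewrite n0 /dot !mul0r addr0 lexx.
  by apply: map_f; exact: HS.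
(* Without an earlier line there is one cell, which the new line cuts in two; the argument with rays
   needs a nonzero earlier normal. *)
have [/allP L0|] := boolP (all (fun m => m == (0, 0)) L).
  have E z : signs L z = nseq (size L) true.
    rewrite /signs -[in RHS](size_map (fun n => 0 <= dot n z) L); apply/all_pred1P.
    apply/allP => _ /mapP[m mL ->] /=; rewrite (eqP (L0 _ mL)).
    by rewrite /dot !mul0r addr0 lexx.
  exists [:: true :: nseq (size L) true; false :: nseq (size L) true]; split; first by rewrite /=; lia.
  by move=> z _; rewrite /= E; case: (0 <= _); rewrite !inE eqxx ?orbT.
rewrite -has_predC => /hasP[m mL /= mn0].
pose d : R * R := (- n.2, n.1).
pose P (s : seq bool) z := off_lines (n :: L) z /\ signs L z = s.
(* [b s] is the side of the new line on which some chosen point of the cell [s] lies. The opposite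
   side is listed only for the cells of the two rays. *)
pose b (s : seq bool) : bool := if pselect (exists z, P s z) is left h
  then 0 <= dot n (projT1 (cid h)) else true.
exists ([seq b s :: s | s <- S] ++ [:: ~~ b (signs L d) :: signs L d;
   ~~ b (signs L (- d.1, - d.2)) :: signs L (- d.1, - d.2)]); split.
  have L0 : (0 < size L)%N by case: (L) mL.
  by move: sS L0; rewrite size_cat size_map /=; lia.
move=> z oz; rewrite mem_cat; set s := signs L z.
have [bE|bE] := eqVneq (0 <= dot n z) (b s).
  apply/orP; left; rewrite /= bE; apply/mapP; exists s => //.
  by apply: HS; case/andP: oz.
apply/orP; right.
have {}bE : (0 <= dot n z) = ~~ b s by move: bE; case: (0 <= _); case: (b s).
suff [sE|sE] : s = signs L d \/ s = signs L (- d.1, - d.2).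
- by rewrite /= -/s bE -sE inE eqxx.
- by rewrite /= -/s bE -sE !inE eqxx orbT.
move: bE; rewrite /b; case: pselect => [h|]; last by case; exists z.
case: (cid h) => z' [oz' sz'] /= bE.
case/andP: oz => oz oL; case/andP: oz' => oz' oL'.
move: oz oz'; rewrite (negbTE nn0) /= => oz oz'.
(* [z] and the chosen point lie in the same cell but strictly on opposite sides of the new line, so
   a positive combination lies on that line and, by convexity, still in the cell. *)
have [a [a' [a0 a'0 E0]]] : exists a a', [/\ 0 < a, 0 < a' & a * dot n z + a' * dot n z' = 0].
  exists `|dot n z'|, `|dot n z|; rewrite !normr_gt0; split => //.
  move: bE; case: (leP 0 (dot n z)); case: (leP 0 (dot n z')) => // h1 h2 _.
  - by rewrite (ltr0_norm h1) (ger0_norm h2); ring.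
  - by rewrite (ltr0_norm h2) (ger0_norm h1); ring.
have [op sp] := signs_comb a0 a'0 oL oL' (esym sz').
move: op sp E0; rewrite -dot_comb; set p := (_, _) => op sp E0.
(* The earlier line [m] keeps [p] away from the origin, so [p] lies on one of the two open rays. *)
have mp : dot m p != 0.
  by move/allP: op => /(_ _ mL); rewrite (negbTE mn0).
have nn : 0 < n.1 ^+ 2 + n.2 ^+ 2.
  rewrite lt_neqAle addr_ge0 ?sqr_ge0// andbT eq_sym paddr_eq0 ?sqr_ge0//.
  by rewrite !sqrf_eq0 -[X in ~~ X]/(n == (0, 0)).
pose t := (n.1 * p.2 - n.2 * p.1) / (n.1 ^+ 2 + n.2 ^+ 2).
have pE : p = (t * d.1, t * d.2).
  have E1 : n.1 * p.1 = - n.2 * p.2 by move: E0; rewrite /dot; lra.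
  have Nn0 : n.1 ^+ 2 + n.2 ^+ 2 != 0 by rewrite gt_eqF.
  have tN : t * (n.1 ^+ 2 + n.2 ^+ 2) = n.1 * p.2 - n.2 * p.1 by rewrite /t divfK.
  rewrite [LHS]surjective_pairing /d /=; congr pair; apply: (mulIf Nn0).
    rewrite mulrAC tN; have := congr1 (fun x => n.1 * x) E1; rewrite /=; lra.
  rewrite mulrAC tN; have := congr1 (fun x => n.2 * x) E1; rewrite /=; lra.
rewrite /s -sp pE.
have [t0|t0|t0] := ltgtP 0 t.
- by left; rewrite signs_scale.
- right; rewrite -(@signs_scale L (- d.1, - d.2) (- t)) ?oppr_gt0//=.
  by congr signs; congr pair; ring.
- by move: mp; rewrite pE dot_scale -t0 mul0r eqxx.
Qed.

End arrangement.

(** * Moments of the Gaussian mixture *)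

Section profile.
Context {R : realType} (K : nat) (p s : 'I_K -> R).
Hypothesis hp : forall k, 0 < p k.
Hypothesis hp1 : \sum_(k < K) p k = 1.
Hypothesis hs : forall k, 0 < s k.
Local Notation mu := (@lebesgue_measure R).

(** The mixture density as a function of the squared modulus: [mix_density p s z] is convertible to
    [profile (sqn z)]. *)
Definition profile (t : R) : R := \sum_(k < K) p k * ((pi * s k)^-1 * expR (- t / s k)).

Lemma profile_ge0 t : 0 <= profile t.
Proof.
apply: sumr_ge0 => k _; rewrite !mulr_ge0 ?expR_ge0 ?(ltW (hp _))//.
by rewrite invr_ge0 mulr_ge0 ?pi_ge0 ?(ltW (hs _)).
Qed.

Lemma measurable_profile : measurable_fun setT profile.
Proof.
apply: measurable_sum => k; apply: measurable_funM => //; apply: measurable_funM => //.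
apply: (measurableT_comp (@measurable_expR R)).
by apply: measurable_funM => //; exact: measurable_oppr.
Qed.

Lemma ler_profile t t' : t <= t' -> profile t' <= profile t.
Proof.
move=> tt'; apply: ler_sum => k _; rewrite !ler_pM2l ?ler_expR//.
  by rewrite ler_pM2r ?invr_gt0// lerN2.
by rewrite invr_gt0 mulr_gt0// pi_gt0.
Qed.

Lemma profile_gt0 t : 0 < profile t.
Proof.
have pk k : 0 < (pi * s k)^-1 * expR (- t / s k).
  by rewrite mulr_gt0 ?expR_gt0// invr_gt0 mulr_gt0// pi_gt0.
have [k0 _] : exists k0 : 'I_K, True.
  apply: contrapT => H; move: hp1; rewrite big1 => [/esym/eqP|k _].
    by rewrite oner_eq0.
  by case: H; exists k.
rewrite /profile (bigD1 k0)//= ltr_pwDl ?(mulr_gt0 (hp _) (pk _))//.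
by apply: sumr_ge0 => k _; rewrite ltW// mulr_gt0.
Qed.

(** With y the exponent, |x|^n <= 1 + x^4 = 1 + 4 c^2 y^2 and y^2 <= 4 (e^y - 1), whence the
    constant 16. *)
Lemma exprn_le_expR (x c : R) (n : nat) : (n <= 4)%N -> 0 < c ->
  `|x| ^+ n <= (1 + 16 * c ^+ 2) * expR (x ^+ 2 / (2 * c)).
Proof.
move=> n4 c0; set y := x ^+ 2 / (2 * c).
have y0 : 0 <= y by rewrite divr_ge0 ?sqr_ge0// mulr_ge0// ltW.
have xy : x ^+ 4 = 4 * c ^+ 2 * y ^+ 2.
  by rewrite /y; field; rewrite gt_eqF.
have ey : 1 + y ^+ 2 / 4 <= expR y.
  have : (1 + y / 2) ^+ 2 <= expR (y / 2) ^+ 2.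
    rewrite ler_sqr ?nnegrE ?expR_ge0//; last lra.
    exact: expR_ge1Dx.
  rewrite expr2 [X in _ <= X]expr2 -expRD -splitr; nra.
have xn : `|x| ^+ n <= 1 + x ^+ 4.
  have x4 : `|x| ^+ 4 = x ^+ 4 by rewrite -normrX ger0_norm// exprn_even_ge0.
  have [x1|x1] := leP `|x| 1.
    by apply: (@le_trans _ _ 1); [exact: exprn_ile1|rewrite lerDl exprn_even_ge0].
  apply: (@le_trans _ _ (`|x| ^+ 4)); last by rewrite x4 lerDr.
  by apply: ler_weXn2l => //; exact: ltW.
apply: (le_trans xn); rewrite xy.
have c2 : 0 <= c ^+ 2 by exact: sqr_ge0.
have := ler_wpM2l (_ : 0 <= 1 + 16 * c ^+ 2) ey => H.
apply: le_trans (H ltac:(lra)).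
have := sqr_ge0 y; have := mulr_ge0 c2 (sqr_ge0 y); lra.
Qed.

Lemma integral_gauss_lty (c : R) : 0 < c ->
  (\int[mu]_x (expR (- (x ^+ 2 / (2 * c))))%:E < +oo)%E.
Proof.
move=> c0; pose b := Num.sqrt (2 * c).
have b0 : 0 < b by rewrite sqrtr_gt0 mulr_gt0.
rewrite (ge0_integral_scale (lt0r_neq0 b0)).
- rewrite (_ : (\int[mu]_x _)%E = (\int[mu]_x (gauss_fun x)%:E)%E); last first.
    apply: eq_integral => x _; rewrite /gauss_fun exprMn sqr_sqrtr ?mulr_ge0 ?ltW//.
    by congr (expR (- _))%:E; field; rewrite gt_eqF.
  by rewrite integralT_gauss -EFinM ltry.
- apply/measurable_EFinP; apply: measurableT_comp; first exact: measurable_expR.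
  apply: measurableT_comp => //; apply: measurable_funM => //; exact: measurable_funX.
- by move=> x; rewrite lee_fin expR_ge0.
Qed.

Lemma measurable_moment (j : nat) :
  measurable_fun setT (fun x : R => `|x| ^+ j * profile (x ^+ 2)).
Proof.
apply: measurable_funM.
  by apply: measurable_funX; exact: normr_measurable.
by apply: (measurableT_comp measurable_profile); exact: measurable_funX.
Qed.

Lemma profile_moment_fin (j : nat) : (j <= 2)%N -> moment profile j \is a fin_num.
Proof.
move=> j2; rewrite ge0_fin_numE; last first.
  by apply: integral_ge0 => x _; rewrite lee_fin mulr_ge0 ?exprn_ge0 ?profile_ge0.
(* One half of the Gaussian exponent absorbs the power of |x|; the other half stays as an integrable
   majorant. *)
pose h (k : 'I_K) (x : R) := p k * (pi * s k)^-1 * (1 + 16 * s k ^+ 2) * expR (- (x ^+ 2 / (2 * s k))).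
have h0 k x : 0 <= h k x.
  rewrite /h !mulr_ge0 ?expR_ge0 ?(ltW (hp _))//.
    by rewrite invr_ge0 mulr_ge0 ?pi_ge0 ?(ltW (hs _)).
  by rewrite addr_ge0// mulr_ge0// sqr_ge0.
have mh k : measurable_fun setT (fun x : R => expR (- (x ^+ 2 / (2 * s k)))).
  apply: measurableT_comp; first exact: measurable_expR.
  apply: measurableT_comp => //; apply: measurable_funM => //; exact: measurable_funX.
have mhk k : measurable_fun setT (h k).
  by apply: measurable_funM; [exact: measurable_cst|exact: mh].
apply: (@le_lt_trans _ _ (\int[mu]_x (\sum_(k < K) (h k x)%:E))%E).
  apply: ge0_le_integral => //.
  - by move=> x _; rewrite lee_fin mulr_ge0 ?exprn_ge0 ?profile_ge0.
  - by apply/measurable_EFinP; exact: measurable_moment.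
  - by apply: emeasurable_sum => k; apply/measurable_EFinP; exact: mhk.
  move=> x _; rewrite sumEFin lee_fin /profile mulr_sumr; apply: ler_sum => k _.
  rewrite /h; set e := expR (- (x ^+ 2 / (2 * s k))).
  have e0 : 0 < e by exact: expR_gt0.
  have E : expR (- x ^+ 2 / s k) = e * e.
    by rewrite -expRD; congr expR; field; rewrite gt_eqF.
  have H : `|x| ^+ j.+1 * e <= 1 + 16 * s k ^+ 2.
    rewrite /e expRN ler_pdivrMr ?expR_gt0//.
    by apply: exprn_le_expR => //; lia.
  have c0 : 0 <= p k * (pi * s k)^-1.
    by rewrite mulr_ge0 ?(ltW (hp _))// invr_ge0 mulr_ge0 ?pi_ge0 ?(ltW (hs _)).
  rewrite E; move: c0 H; set v := (pi * s k)^-1; set w := `|x| ^+ _ => c0 H.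
  rewrite (_ : w * (p k * (v * (e * e))) = p k * v * (w * e) * e); last by ring.
  by apply: ler_wpM2r; [exact: ltW|exact: ler_wpM2l].
rewrite ge0_integral_sum//.
- rewrite lte_sum_pinfty// => k _.
  under eq_integral do rewrite EFinM.
  rewrite ge0_integralZl//.
  + rewrite lte_mul_pinfty//; first last.
    * exact: integral_gauss_lty.
    * rewrite lee_fin !mulr_ge0 ?(ltW (hp _))//.
        by rewrite invr_ge0 mulr_ge0 ?pi_ge0 ?(ltW (hs _)).
      by rewrite addr_ge0// mulr_ge0// sqr_ge0.
  + by apply/measurable_EFinP; exact: mh.
  + rewrite lee_fin !mulr_ge0 ?(ltW (hp _))//.
      by rewrite invr_ge0 mulr_ge0 ?pi_ge0 ?(ltW (hs _)).
    by rewrite addr_ge0// mulr_ge0// sqr_ge0.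
- by move=> k; apply/measurable_EFinP; exact: mhk.
- by move=> k x _; rewrite lee_fin.
Qed.

Lemma profile_moment_gt0 (j : nat) : (0 < moment profile j)%E.
Proof.
have m0 x : (0 <= (`|x| ^+ j.+1 * profile (x ^+ 2))%:E)%E.
  by rewrite lee_fin mulr_ge0 ?exprn_ge0 ?profile_ge0.
(* On [1, 2] the power is at least 1 and the decreasing profile is at least its value at 4. *)
apply: (@lt_le_trans _ _ (profile 4)%:E); first by rewrite lte_fin profile_gt0.
apply: (@le_trans _ _ (\int[mu]_(x in `[1%R, 2%R]) (`|x| ^+ j.+1 * profile (x ^+ 2))%:E)%E).
  rewrite (_ : (profile 4)%:E = \int[mu]_(x in `[1%R, 2%R]) (profile 4)%:E)%E; last first.
    rewrite integral_cst//= lebesgue_measure_itv /= lte_fin ltr1n -EFinB.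
    by rewrite -EFinM; congr (_%:E); lra.
  apply: ge0_le_integral => //.
  - by move=> x _; rewrite lee_fin profile_ge0.
  - by apply/measurable_EFinP/measurable_funTS; exact: measurable_moment.
  move=> x /=; rewrite in_itv /= => /andP[x1 x2]; rewrite lee_fin.
  rewrite -[leLHS]mul1r ler_pM ?profile_ge0//.
    by rewrite exprn_ege1// ger0_norm//; lra.
  by apply: ler_profile; nra.
apply: ge0_subset_integral => //.
by apply/measurable_EFinP; exact: measurable_moment.
Qed.

End profile.

(** * Cells of the one-bit observation *)

Section sign_patterns.
Context {R : realType} (M : nat).
Implicit Types (a : 'I_M -> R[i]) (z n : R * R).

(** The observation recoded in a finite type, so that sums over cells are finite; [unpattern]
    translates back injectively. *)
Definition pattern a z : {ffun 'I_M -> bool * bool} :=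
  [ffun m => (0 <= complex.Re (a m * cplx z), 0 <= complex.Im (a m * cplx z))].

Definition unpattern (v : {ffun 'I_M -> bool * bool}) : 'I_M -> R[i] := fun m =>
  Complex ((if (v m).1 then 1 else -1) / Num.sqrt 2) ((if (v m).2 then 1 else -1) / Num.sqrt 2).

Lemma obsE a z : obs a z = unpattern (pattern a z).
Proof. by apply/funext => m; rewrite /obs /unpattern ffunE. Qed.

Lemma unpattern_inj : injective unpattern.
Proof.
have s2 : (Num.sqrt 2 : R) != 0 by rewrite gt_eqF// sqrtr_gt0.
have signI (x y : bool) : (if x then 1 else -1 : R) / Num.sqrt 2 = (if y then 1 else -1) / Num.sqrt 2 -> x = y.
  by move=> /(mulIf (invr_neq0 s2)); case: x; case: y => // H; lra.
move=> v w vw; apply/ffunP => m; have := congr1 (fun f => f m) vw; rewrite /unpattern.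
by move=> [/signI + /signI]; case: (v m) => ? ?; case: (w m) => ? ? /= -> ->.
Qed.

Lemma obs_event_unpattern a v : obs_event a (unpattern v) = fiber (pattern a) v.
Proof.
by apply/seteqP; split => z; rewrite /obs_event /fiber /= obsE; [move/unpattern_inj|move=> ->].
Qed.

Definition normal_re a m : R * R := (complex.Re (a m), - complex.Im (a m)).
Definition normal_im a m : R * R := (complex.Im (a m), complex.Re (a m)).

Lemma dot_normal_re a m z : dot (normal_re a m) z = complex.Re (a m * cplx z).
Proof. by rewrite /dot /normal_re /cplx; case: (a m) => x y /=; ring. Qed.

Lemma dot_normal_im a m z : dot (normal_im a m) z = complex.Im (a m * cplx z).
Proof. by rewrite /dot /normal_im /cplx; case: (a m) => x y /=; ring. Qed.

Lemma measurable_dot n : measurable_fun setT (dot n).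
Proof. by case: (quad_growth_dot n). Qed.

Lemma measurable_halfplane n (b : bool) : measurable [set z : R * R | (0 <= dot n z) = b].
Proof.
have H : measurable [set z : R * R | 0 <= dot n z].
  rewrite -[X in measurable X]setTI; apply: measurable_fun_le => //; exact: measurable_dot.
case: b; first by [].
rewrite (_ : mkset _ = ~` [set z | 0 <= dot n z]); first exact: measurableC.
by apply/seteqP; split => z /=; [move=> ->|move/negP/negbTE].
Qed.

Lemma fiber_patternE a v : fiber (pattern a) v = \bigcap_(m in [set: 'I_M])
  ([set z | (0 <= dot (normal_re a m) z) = (v m).1] `&` [set z | (0 <= dot (normal_im a m) z) = (v m).2]).
Proof.
apply/seteqP; split => z.
  by move=> <- m _ /=; rewrite ffunE /= dot_normal_re dot_normal_im.
move=> H; apply/ffunP => m; have [/= + +] := H m I.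
by rewrite ffunE dot_normal_re dot_normal_im => -> ->; case: (v m).
Qed.

Lemma measurable_pattern a v : measurable (fiber (pattern a) v).
Proof.
rewrite fiber_patternE; apply: fin_bigcap_measurable => // m _.
by apply: measurableI; exact: measurable_halfplane.
Qed.

Lemma cone_pattern a v : cone (fiber (pattern a) v).
Proof.
move=> r z r0; rewrite /fiber /= (_ : pattern a (r * z.1, r * z.2) = pattern a z)//.
by apply/ffunP => m; rewrite !ffunE -!dot_normal_re -!dot_normal_im !dot_scale !pmulr_rge0.
Qed.

Definition normals a : seq (R * R) :=
  [seq normal_re a m | m <- enum 'I_M] ++ [seq normal_im a m | m <- enum 'I_M].

Definition pattern_of_signs (s : seq bool) : {ffun 'I_M -> bool * bool} :=
  [ffun m : 'I_M => (nth true s m, nth true s (M + m))].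

Lemma patternE a z : pattern a z = pattern_of_signs (signs (normals a) z).
Proof.
have -> : signs (normals a) z = [seq 0 <= dot (normal_re a m) z | m <- enum 'I_M] ++
    [seq 0 <= dot (normal_im a m) z | m <- enum 'I_M].
  by rewrite /signs /normals map_cat; congr cat; rewrite -map_comp.
apply/ffunP => m; rewrite !ffunE !nth_cat size_map size_enum_ord ltn_ord ltnNge leq_addr /= addKn.
have nthE (f : 'I_M -> bool) : nth true [seq f i | i <- enum 'I_M] m = f m.
  by rewrite (nth_map m) ?size_enum_ord ?ltn_ord// nth_ord_enum.
by rewrite !nthE dot_normal_re dot_normal_im.
Qed.

Definition line n : set (R * R) := [set z | dot n z = 0].

Lemma measurable_line n : measurable (line n).
Proof.
rewrite -[line n]setTI (_ : line n = dot n @^-1` [set 0])//.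
by apply: measurable_dot => //; exact: measurable_set1.
Qed.

Lemma cone_line n : cone (line n).
Proof.
move=> r z r0; rewrite /line /= dot_scale; split => [/eqP|->]; last by rewrite mulr0.
by rewrite mulf_eq0 gt_eqF//= => /eqP.
Qed.

(** In the slope coordinate a line is at most one point. *)
Lemma Theta_line n : n != (0, 0) -> Theta (line n) = 0.
Proof.
move=> nn0.
(* If [n.2 = 0] then [t0] is the junk value [0] and the vertical line has no slope at all. *)
pose t0 := - n.1 / n.2.
have H t : t != t0 -> n.1 + n.2 * t != 0.
  move=> tt0; apply: contra_neq tt0 => E; rewrite /t0.
  have n2 : n.2 != 0.
    apply: contra_neq nn0 => n2; move: E; rewrite n2 mul0r addr0 => n1.
    by rewrite [n]surjective_pairing n1 n2.
  by rewrite (_ : - n.1 = n.2 * t); [field|lra].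
rewrite /Theta; set f := (X in (\int[_]_t X t)%E).
rewrite (_ : f = f \_ [set t0]); last first.
  apply/funext => t; rewrite patchE; case: ifPn => //; rewrite notin_setE /= => /eqP tt0.
  rewrite /f !indicE !memNset ?addr0 ?mul0r// /line /dot /=.
    by move=> E; have := H _ tt0; rewrite -oppr_eq0 (_ : - _ = 0) ?eqxx//; rewrite -E; ring.
  by move=> E; have := H _ tt0; rewrite (_ : _ + _ = 0) ?eqxx//; rewrite -E; ring.
by rewrite -integral_mkcond integral_set1.
Qed.

End sign_patterns.

(** * Number of cells and optimality of centroids *)

Section cells.
Context {R : realType} (M : nat).
Variables (q : R -> R).
Hypothesis mq : measurable_fun setT q.
Hypothesis q0 : forall t, 0 <= q t.
Hypothesis moment_fin : forall j, (j <= 2)%N -> moment q j \is a fin_num.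
Hypothesis moment_gt0 : forall j, (j <= 1)%N -> (0 < moment q j)%E.
Implicit Types (a : 'I_M -> R[i]).

(** Points on the lines can show extra patterns, which [count_signs] does not count. A cell made
    only of such points is covered by finitely many lines, hence null. *)
Lemma nonnull_cell_off_lines a v : Theta (fiber (pattern a) v) != 0 ->
  exists2 z, off_lines (normals a) z & pattern a z = v.
Proof.
move=> T0; apply: contrapT => H; move/negP: T0; apply.
have mom0 := mom_gt0 moment_fin moment_gt0 (isT : (0 <= 1)%N).
have E : mom q 0 * Theta (fiber (pattern a) v) <= 0.
  rewrite -(Ex_indic mq q0 moment_fin); [|exact: measurable_pattern|exact: cone_pattern].
  pose L := [seq n <- normals a | n != (0, 0)].
  have -> : 0 = Ex q (fun z => \sum_(n <- L) \1_(line n) z).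
    rewrite (Ex_sum mq q0 moment_fin); last by move=> n; apply: quad_growth_indic1; exact: measurable_line.
    rewrite big_seq big1// => n; rewrite mem_filter => /andP[nn0 _].
    rewrite (Ex_indic mq q0 moment_fin); [|exact: measurable_line|exact: cone_line].
    by rewrite Theta_line ?mulr0.
  apply: (Ex_le mq q0 moment_fin).
  - by apply: quad_growth_indic1; exact: measurable_pattern.
  - by apply: quad_growth_sum => n; apply: quad_growth_indic1; exact: measurable_line.
  move=> z; rewrite indicE; have [|_] := boolP (z \in _); last first.
    by apply: sumr_ge0 => n _; rewrite indicE.
  rewrite inE => zv.
  have : ~~ off_lines (normals a) z by apply/negP => oz; apply: H; exists z.
  rewrite -has_predC => /hasP[n nL /=]; rewrite negb_or negbK => /andP[nn0 /eqP dn].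
  rewrite (big_rem n) ?mem_filter ?nn0//= indicE mem_set// lerDl.
  by apply: sumr_ge0 => m _; rewrite indicE.
by apply/eqP/le_anti; rewrite Theta_ge0 andbT; move: E; rewrite pmulr_rle0.
Qed.

Lemma card_nonnull_cells a : (0 < M)%N ->
  (#|[pred v | Theta (fiber (pattern a) v) != 0%R]| <= 4 * M)%N.
Proof.
move=> M0; have [S [sS HS]] := count_signs (normals a).
have sN : (size (normals a) = 2 * M)%N.
  by rewrite size_cat 2!size_map !size_enum_ord addnn mul2n.
apply: (@leq_trans (size (map (pattern_of_signs M) S))); last first.
  by rewrite size_map; move: sS; rewrite sN; lia.
apply: leq_trans (card_size _); apply: subset_leq_card; apply/fintype.subsetP => v.
rewrite inE => /nonnull_cell_off_lines[z oz <-].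
by rewrite patternE; apply: map_f; exact: HS.
Qed.

Lemma Ex_indic_dotE (A : set (R * R)) (c : R * R) : measurable A ->
  Ex q (fun z => \1_A z * dot c z) =
  c.1 * Ex q (fun z => \1_A z * z.1) + c.2 * Ex q (fun z => \1_A z * z.2).
Proof.
move=> mA.
have g1 : quad_growth (fun z => \1_A z * z.1) by apply: quad_growth_indic => //; exact: quad_growth_fst.
have g2 : quad_growth (fun z => \1_A z * z.2) by apply: quad_growth_indic => //; exact: quad_growth_snd.
rewrite -!(ExZ mq q0 moment_fin)// -(ExD mq q0 moment_fin); [|exact: quad_growthZ..].
by congr Ex; apply/funext => z; rewrite /dot; ring.
Qed.

(* Nothing is assumed about [c] on null cells, where [cond_mean] is [0] by convention. *)
Lemma centroid_optimal (A : set (R * R)) (c g : R * R) : measurable A -> cone A ->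
  (Ex q \1_A != 0 ->
    c.1 = Ex q (fun z => \1_A z * z.1) / Ex q \1_A /\
    c.2 = Ex q (fun z => \1_A z * z.2) / Ex q \1_A) ->
  Ex q (fun z => \1_A z * sqd c z) <= Ex q (fun z => \1_A z * sqd g z).
Proof.
move=> mA cA cE; have P0 := Ex_indic mq q0 moment_fin mA cA.
rewrite !(Ex_indic_sqd mq q0 moment_fin)// -P0.
have [E|Pn0] := eqVneq (Ex q \1_A) 0.
  have T0 : Theta A = 0.
    apply/eqP; move: E; rewrite P0 => /eqP; rewrite mulf_eq0 => /orP[|//].
    by rewrite (gt_eqF (mom_gt0 moment_fin moment_gt0 _)).
  (* On a null cell both first moments vanish, as the bound in the four axis directions shows, so
     both sides are 0. *)
  have H e : e.1 ^+ 2 + e.2 ^+ 2 = 1 -> Ex q (fun z => \1_A z * dot e z) <= 0.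
    by move=> e1; have := Ex_dot_le_rho mq q0 moment_fin mA cA e1; rewrite T0 mulr0.
  have h1 : (1 : R) ^+ 2 + 0 ^+ 2 = 1 by ring.
  have h2 : (-1 : R) ^+ 2 + 0 ^+ 2 = 1 by ring.
  have h3 : (0 : R) ^+ 2 + 1 ^+ 2 = 1 by ring.
  have h4 : (0 : R) ^+ 2 + (-1) ^+ 2 = 1 by ring.
  have := H (1, 0) h1; have := H (-1, 0) h2; have := H (0, 1) h3; have := H (0, -1) h4.
  rewrite !Ex_indic_dotE//= !mul1r !mul0r !mulN1r !addr0 !add0r => k1 k2 k3 k4.
  have -> : Ex q (fun z => \1_A z * z.1) = 0 by lra.
  have -> : Ex q (fun z => \1_A z * z.2) = 0 by lra.
  by rewrite E; lra.
have Pgt : 0 < Ex q \1_A.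
  by rewrite lt_neqAle eq_sym Pn0 (Ex_ge0 q0)// => z; rewrite indicE.
have [c1 c2] := cE Pn0; rewrite !Ex_indic_dotE//.
move: c1 c2 Pgt; rewrite /sqn.
set m1 := Ex q (fun z => \1_A z * z.1); set m2 := Ex q (fun z => \1_A z * z.2).
set P := Ex q \1_A => c1 c2 Pgt.
have {c1} m1E : m1 = c.1 * P by rewrite c1 divfK.
have {c2} m2E : m2 = c.2 * P by rewrite c2 divfK.
(* The two distortions differ by exactly [P * sqd c g]. *)
have := mulr_ge0 (ltW Pgt) (sqd_ge0 c g); rewrite /sqd m1E m2E.
lra.
Qed.

End cells.

(** * The equidistant pilot *)

Section equidistant.
Context {R : realType} (M : nat).
Hypothesis M0 : (0 < M)%N.
Implicit Types (z : R * R) (k j : nat).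

Definition phase_step : R := pi / (2 * M%:R).

Lemma phase_step_bounds : 0 < phase_step <= pi / 2.
Proof.
have M1 : (1 : R) <= M%:R by rewrite ler1n.
rewrite /phase_step divr_gt0 ?pi_gt0//=; last by rewrite mulr_gt0// (lt_le_trans _ M1).
rewrite ler_pM2l ?pi_gt0// lef_pV2 ?posrE//; last by rewrite mulr_gt0// (lt_le_trans _ M1).
lra.
Qed.

Lemma phase_step2M : (2 * M)%:R * phase_step = pi.
Proof. by rewrite /phase_step natrM; field; rewrite pnatr_eq0 -lt0n. Qed.

(* The imaginary part of [z exp (i j phase_step)]. *)
Definition level z j : R := z.2 * cos (j%:R * phase_step) + z.1 * sin (j%:R * phase_step).

Lemma level_half_turn z j : level z (j + 2 * M) = - level z j.
Proof.
rewrite /level natrD mulrDl phase_step2M.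
have -> : cos (j%:R * phase_step + pi) = - cos (j%:R * phase_step) by rewrite cosD sinpi cospi; ring.
have -> : sin (j%:R * phase_step + pi) = - sin (j%:R * phase_step) by rewrite sinD sinpi cospi; ring.
by ring.
Qed.

(** Midpoint of the arc of arguments from pi - (k + 1) [phase_step] to pi - k [phase_step], where
    level k is nonnegative and level k + 1 nonpositive. *)
Definition arc_center k : R * R :=
  (cos (pi - phase_step / 2 - k%:R * phase_step), sin (pi - phase_step / 2 - k%:R * phase_step)).

Lemma arc_center_unit k : (arc_center k).1 ^+ 2 + (arc_center k).2 ^+ 2 = 1.
Proof. by rewrite /= cos2Dsin2. Qed.

(** In the frame [w] turned to the arc center, the two inequalities become |w.2| cos d <= w.1 sin
    d. *)
Lemma sector_of_levels z k : 0 <= level z k -> level z k.+1 <= 0 ->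
  sector (phase_step / 2) (rotz ((arc_center k).1, - (arc_center k).2) z).
Proof.
have [u0 u1] := andP phase_step_bounds.
set d := phase_step / 2; set w := rotz _ z => h1 h2.
have zE : z = rotz (arc_center k) w by rewrite /w -{1}[z](rotzK _ (arc_center_unit k)); move: (arc_center k) => [a b]; rewrite /rotz /=; congr pair; ring.
clearbody w.
have pi2 := @pi_ge2 R.
have sd : 0 < sin d by apply: sin_gt0_pihalf; rewrite /d; lra.
have cd : 0 < cos d by apply: cos_gt0_pihalf; rewrite /d; lra.
have e1 : level z k = w.1 * sin d - w.2 * cos d.
  rewrite {1}zE /level /rotz /arc_center /= -/d.
  have -> : pi - d - k%:R * phase_step = pi - (d + k%:R * phase_step) by ring.
  rewrite !(cosB pi) !(sinB pi) !cospi !sinpi !sinD !cosD.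
  have := cos2Dsin2 (k%:R * phase_step); move: (cos (_ * _)) (sin (_ * _)) => c s cs.
  have -> : w.1 * sin d - w.2 * cos d = (w.1 * sin d - w.2 * cos d) * (c ^+ 2 + s ^+ 2) by rewrite cs mulr1.
  by ring.
have e2 : level z k.+1 = - w.1 * sin d - w.2 * cos d.
  have E1 : k.+1%:R * phase_step = k%:R * phase_step + phase_step by rewrite -[k.+1]addn1 natrD; ring.
  rewrite {1}zE /level E1 /rotz /arc_center /= -/d.
  have -> : phase_step = d + d by rewrite /d -splitr.
  have -> : pi - d - k%:R * (d + d) = pi - (d + k%:R * (d + d)) by ring.
  rewrite !(cosB pi) !(sinB pi) !cospi !sinpi !sinD !cosD ?sinD.
  set x := k%:R * _.
  have := cos2Dsin2 x; have := cos2Dsin2 d.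
  move: (cos x) (sin x) (cos d) (sin d) => c s C S CS cs.
  have -> : - w.1 * S - w.2 * C = (- w.1 * S - w.2 * C) * (c ^+ 2 + s ^+ 2) * (C ^+ 2 + S ^+ 2) by rewrite cs CS; ring.
  by ring.
move: h1 h2; rewrite e1 e2 => h1 h2.
have w1 : 0 <= w.1 by rewrite -(pmulr_lge0 _ sd); lra.
rewrite /sector /= -ler_sqr ?nnegrE ?mulr_ge0 ?rho_ge0 ?(ltW cd)// exprMn rho2 /sqn.
have : (w.2 * cos d) ^+ 2 <= (w.1 * sin d) ^+ 2.
  by rewrite -[leLHS]real_normK ?num_real// ler_sqr ?nnegrE ?normr_ge0 ?mulr_ge0 ?(ltW sd)// ler_norml; lra.
rewrite !exprMn (sin2cos2 d); lra.
Qed.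

(* The levels at [0, ..., 2 M - 1] change sign as functions on the circle of indices of
   length [4 M], since [level_half_turn] flips them; the position of a change only
   depends on the signs. *)
Lemma sector_of_signs z0 : exists2 k, (k < 4 * M)%N &
  forall z, (forall j, (j < 2 * M)%N -> (0 <= level z j) = (0 <= level z0 j)) ->
    sector (phase_step / 2) (rotz ((arc_center k).1, - (arc_center k).2) z).
Proof.
have [[j [jM jne]]|H] := pselect (exists j, (j.+1 < 2 * M)%N /\
    (0 <= level z0 j) != (0 <= level z0 j.+1)).
  have [h0|h0] := leP 0 (level z0 j).
    exists j; first by lia.
    move=> z Hz; apply: sector_of_levels; first by rewrite Hz//; lia.
    move: jne; rewrite -(Hz j.+1)// h0.
    by case: leP => // /ltW.
  (* A change from negative to nonnegative becomes one in the required direction half a turn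
     later. *)
  exists (j + 2 * M)%N; first by lia.
  move=> z Hz; apply: sector_of_levels.
    by rewrite level_half_turn oppr_ge0 ltW// ltNge Hz ?leNgt ?h0//; lia.
  rewrite -addSn level_half_turn oppr_le0 Hz//.
  by move: jne; rewrite leNgt h0 /=; case: leP.
(* With constant signs on the half circle, the change occurs between 2 M - 1 and 2 M, the half turn
   of index 0. *)
have {}H j : (j < 2 * M)%N -> (0 <= level z0 j) = (0 <= level z0 0).
  elim: j => // j ih jM; rewrite -ih; last by lia.
  by apply: contrapT => ne; apply: H; exists j; split => //; apply/eqP => E; apply: ne.
have lastM : ((2 * M).-1 < 2 * M)%N by lia.
have lastS : ((2 * M).-1.+1 = 0 + 2 * M)%N by lia.
have [h0|h0] := leP 0 (level z0 0).
  exists (2 * M).-1; first by lia.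
  move=> z Hz; apply: sector_of_levels; first by rewrite Hz// H.
  by rewrite lastS level_half_turn oppr_le0 Hz//; lia.
exists ((2 * M).-1 + 2 * M)%N; first by lia.
move=> z Hz; apply: sector_of_levels.
  by rewrite level_half_turn oppr_ge0 ltW// ltNge Hz// H// -ltNge.
rewrite -addSn lastS !level_half_turn opprK ltW// ltNge Hz; last by lia.
by rewrite -ltNge.
Qed.

(** Level j is the imaginary part seen by entry j when j < M. Otherwise it is the real part seen by
    entry j - M, since M steps make a right angle. *)
Lemma levels_of_pattern z z0 :
  pattern (@equi_pilot R M) z = pattern (@equi_pilot R M) z0 ->
  forall j, (j < 2 * M)%N -> (0 <= level z j) = (0 <= level z0 j).
Proof.
move=> E j jM.
have Mn0 : (M%:R : R) != 0 by rewrite pnatr_eq0 -lt0n.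
have ang (m : nat) : pi * m%:R / (2 * M%:R) = m%:R * phase_step by rewrite /phase_step; ring.
have [jlt|jge] := ltnP j M.
  have Ej y : level y j = complex.Im (@equi_pilot R M (Ordinal jlt) * cplx y).
    by rewrite -dot_normal_im /dot /normal_im /equi_pilot /level /= ang; ring.
  have := congr1 (fun v : {ffun 'I_M -> bool * bool} => (v (Ordinal jlt)).2) E.
  by rewrite !ffunE !Ej.
have jlt : (j - M < M)%N by lia.
have Ej y : level y j = complex.Re (@equi_pilot R M (Ordinal jlt) * cplx y).
  rewrite -dot_normal_re /dot /normal_re /equi_pilot /level /= ang.
  have -> : j%:R * phase_step = (j - M)%:R * phase_step + pi / 2.
    by rewrite natrB// mulrBl (_ : M%:R * phase_step = pi / 2) ?subrK// /phase_step; field.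
  by rewrite cosDpihalf sinDpihalf; ring.
have := congr1 (fun v : {ffun 'I_M -> bool * bool} => (v (Ordinal jlt)).1) E.
by rewrite !ffunE !Ej.
Qed.

End equidistant.

(** * Mean square error *)

Section mse.
Context {R : realType} (K : nat) (p s : 'I_K -> R).
Hypothesis hp : forall k, 0 < p k.
Hypothesis hp1 : \sum_(k < K) p k = 1.
Hypothesis hs : forall k, 0 < s k.
Context (M : nat).
Hypothesis M0 : (0 < M)%N.
Implicit Types (a : 'I_M -> R[i]) (z : R * R).
Local Notation q := (profile p s).

Let mq := measurable_profile p s.
Let q0 := profile_ge0 hp hs.
Let moment_fin := profile_moment_fin hp hs.
Let moment_gt0 j (_ : (j <= 1)%N) := profile_moment_gt0 hp hp1 hs j.

Lemma EmixE (F : R * R -> R) : quad_growth F -> Emix p s F = (Ex q F)%:E.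
Proof. exact: (quad_growth_fin mq q0 moment_fin). Qed.

Definition representative a v : R * R :=
  let w := cond_mean p s a (unpattern v) in (complex.Re w, complex.Im w).

Lemma mseE a : mse_cme p s a =
  (Ex q (fun z => sqd (representative a (pattern a z)) z))%:E.
Proof.
rewrite /mse_cme (_ : (fun z => _) =
  (fun z => sqd (representative a (pattern a z)) z)); last first.
  apply/funext => z; rewrite obsE /representative /abs2 /sqd /cplx.
  by case: (cond_mean _ _ _ _) => x y /=.
rewrite EmixE//; apply: (quad_growth_fiber (f := fun v z => sqd (representative a v) z)).
  exact: measurable_pattern.
by move=> v; exact: quad_growth_sqd.
Qed.

Lemma indic_obs_event a v z : Defs.indic (obs_event a (unpattern v)) z = \1_(fiber (pattern a) v) z.
Proof.
rewrite obs_event_unpattern /Defs.indic indicE; case: asboolP => H; first by rewrite mem_set.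
by rewrite memNset.
Qed.

Lemma representative_centroid a v : let A := fiber (pattern a) v in Ex q \1_A != 0 ->
  (representative a v).1 = Ex q (fun z => \1_A z * z.1) / Ex q \1_A /\
  (representative a v).2 = Ex q (fun z => \1_A z * z.2) / Ex q \1_A.
Proof.
move=> A PA; have mA : measurable A by exact: measurable_pattern.
have e0 : Emix p s (Defs.indic (obs_event a (unpattern v))) = (Ex q \1_A)%:E.
  rewrite (_ : Defs.indic _ = \1_A); last by apply/funext => z; exact: indic_obs_event.
  by rewrite EmixE//; exact: quad_growth_indic1.
have e1 : Emix p s (fun z => z.1 * Defs.indic (obs_event a (unpattern v)) z) =
    (Ex q (fun z => \1_A z * z.1))%:E.
  rewrite (_ : (fun z => _) = (fun z => \1_A z * z.1)).
    by rewrite EmixE//; apply: quad_growth_indic => //; exact: quad_growth_fst.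
  by apply/funext => z; rewrite indic_obs_event mulrC.
have e2 : Emix p s (fun z => z.2 * Defs.indic (obs_event a (unpattern v)) z) =
    (Ex q (fun z => \1_A z * z.2))%:E.
  rewrite (_ : (fun z => _) = (fun z => \1_A z * z.2)).
    by rewrite EmixE//; apply: quad_growth_indic => //; exact: quad_growth_snd.
  by apply/funext => z; rewrite indic_obs_event mulrC.
by rewrite /representative /cond_mean e0 e1 e2 /= (negbTE PA).
Qed.

(** Since 4 M steps make a full turn, this is 4 M times the distortion of one sector of angle
    [phase_step M] about its centroid. *)
Definition optimal_mse : R :=
  (mom q 2 - gain q * chord_slope (phase_step M)) * (2 * pi)
  - (4 * M)%:R * (gain q * chord_icept (phase_step M)).

Lemma mse_ge a : (optimal_mse%:E <= mse_cme p s a)%E.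
Proof.
rewrite mseE lee_fin; apply: (quantizer_ge mq q0 moment_fin moment_gt0).
- exact: measurable_pattern.
- exact: cone_pattern.
- exact: phase_step_bounds.
- exact: (card_nonnull_cells mq q0 moment_fin moment_gt0).
Qed.

Lemma mse_le_quantizer a (g : {ffun 'I_M -> bool * bool} -> R * R) :
  (mse_cme p s a <= (Ex q (fun z => sqd (g (pattern a z)) z))%:E)%E.
Proof.
have mf := measurable_pattern a.
rewrite mseE lee_fin.
rewrite (Ex_fiber mq q0 moment_fin (f := fun v => sqd (representative a v)) mf); last first.
  by move=> v; exact: quad_growth_sqd.
rewrite (Ex_fiber mq q0 moment_fin (f := fun v => sqd (g v)) mf); last first.
  by move=> v; exact: quad_growth_sqd.
apply: ler_sum => v _; apply: (centroid_optimal mq q0 moment_fin moment_gt0) => //.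
  exact: cone_pattern.
exact: representative_centroid.
Qed.

(** No bijection between cells and sectors is built: each point lies in the sector assigned to its
    pattern, so the distortion is at most the sum over all 4 M sectors, which is already the
    optimum. *)
Lemma mse_equi_le : (mse_cme p s (@equi_pilot R M) <= optimal_mse%:E)%E.
Proof.
have [u0 u1] := andP (@phase_step_bounds R M M0).
pose u : R := phase_step M; pose t := centroid q u.
pose S k z := sector (u / 2) (rotz ((arc_center M k).1, - (arc_center M k).2) z).
pose rep k : R * R := (t * (arc_center M k).1, t * (arc_center M k).2).
pose P v (k : 'I_(4 * M)) := forall z, pattern (@equi_pilot R M) z = v -> S k z.
(* The default [0] is never reached at the pattern of a point, by [sector_of_signs]. *)
pose g v : R * R := if pselect (exists k, P v k) is left h then rep (projT1 (cid h)) else 0.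
have gP z : exists2 k : 'I_(4 * M), S k z & g (pattern (@equi_pilot R M) z) = rep k.
  rewrite /g; case: pselect => [h|]; last first.
    have [k kM Hk] := sector_of_signs M0 z; case; exists (Ordinal kM) => z' E.
    by apply: Hk; exact: levels_of_pattern.
  by case: (cid h) => k Pk /=; exists k => //; exact: Pk.
apply: le_trans (mse_le_quantizer _ g) _; rewrite lee_fin.
pose F (k : 'I_(4 * M)) z := \1_(sector (u / 2)) (rotz ((arc_center M k).1, - (arc_center M k).2) z) * sqd (rep k) z.
have F0 k z : 0 <= F k z by rewrite mulr_ge0 ?sqd_ge0// indicE.
have gF k : quad_growth (F k).
  have mS := @measurable_sector R (u / 2).
  apply: (quad_growth_dom _ (quad_growth_sqd (rep k))).
    apply: measurable_funM; last by case: (quad_growth_sqd (rep k)).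
    apply: measurableT_comp; [exact: measurable_indic|exact: measurable_rotz].
  move=> z; rewrite normrM ler_piMl// indicE; case: (_ \in _); rewrite ?normr1 ?normr0//.
apply: (@le_trans _ _ (Ex q (fun z => \sum_(k < 4 * M) F k z))).
  apply: (Ex_le mq q0 moment_fin).
  - apply: (quad_growth_fiber (f := fun v => sqd (g v))); first exact: measurable_pattern.
    by move=> v; exact: quad_growth_sqd.
  - exact: quad_growth_sum.
  move=> z; have [k Sk ->] := gP z.
  rewrite (bigD1 k)//= {1}/F indicE mem_set// mul1r lerDl.
  by apply: sumr_ge0.
rewrite (Ex_sum mq q0 moment_fin)//.
have uM : (4 * M)%:R * u = 2 * pi.
  by have := @phase_step2M R M M0; rewrite -/u !natrM => <-; ring.
have E k : Ex q (F k) = (mom q 2 - gain q * chord_slope u) * u - gain q * chord_icept u.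
  apply: (sector_distortion mq q0 moment_fin moment_gt0); last exact: arc_center_unit.
  by have := @pi_ge2 R; rewrite /u; lra.
rewrite (eq_bigr _ (fun k _ => E k)) sumr_const card_ord -mulr_natl.
rewrite /optimal_mse -/u -uM le_eqVlt; apply/orP; left; apply/eqP; ring.
Qed.

End mse.

Lemma sum_abs2_equi_pilot (R : realType) (M : nat) :
  \sum_(m < M) abs2 (@equi_pilot R M m) = M%:R.
Proof.
under eq_bigr => m _ do rewrite /abs2 /equi_pilot /= cos2Dsin2.
by rewrite sumr_const card_ord.
Qed.

Theorem theorem4 (R : realType) (K : nat) (p s : 'I_K -> R)
    (hp : forall k, 0 < p k) (hp1 : \sum_(k < K) p k = 1)
    (hs : forall k, 0 < s k) (M : nat) :
  (\sum_(m < M) abs2 (@equi_pilot R M m) = M%:R) /\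
  forall a : 'I_M -> R[i], \sum_(m < M) abs2 (a m) = M%:R ->
    (mse_cme p s (@equi_pilot R M) <= mse_cme p s a)%E.
Proof.
split; first exact: sum_abs2_equi_pilot.
(* For M = 0 the empty pilot is the only one. *)
move=> a _; case: (posnP M) a => [->|M0] a.
  by rewrite (_ : a = @equi_pilot R 0)//; apply/funext => -[].
exact: le_trans (mse_equi_le hp hp1 hs M0) (mse_ge hp hp1 hs M0 a).
Qed.
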